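(* Let $U$ be a normal ultrafilter on a measurable cardinal $\delta$ and let $\lambda$ be a limit ordinal. (i) If the cardinal $\mathrm{cof}(\lambda)$ is either smaller than $\delta^+$ or weakly compact, then no unbounded subset of $\lambda$ is fresh over $\mathrm{Ult}(V,U)$. (ii) If $\mathrm{cof}(\lambda)>2^\delta$ and there exists a ${<}(2^\delta)^+$-closed ultrafilter on $\mathrm{cof}(\lambda)$ that contains all cobounded subsets of $\mathrm{cof}(\lambda)$, then no unbounded subset of $\lambda$ is fresh over $\mathrm{Ult}(V,U)$. In particular, if there exists a strongly compact cardinal $\kappa$ with $\delta<\kappa\leq\mathrm{cof}(\lambda)$, then no unbounded subset of $\lambda$ is fresh over $\mathrm{Ult}(V,U)$.
   Context: We work in ZFC; $V$ is the universe of sets. For a normal ultrafilter $U$ on a measurable cardinal $\delta$, $\mathrm{Ult}(V,U)$ denotes the transitive collapse of the ultrapower of $V$ by $U$. Given a class $M$, a set $A$ of ordinals is fresh over $M$ if $A\notin M$ and $A\cap\alpha\in M$ for all $\alpha<\mathrm{lub}(A)$, where $\mathrm{lub}(A)$ is the least upper bound of $A$ (so $\mathrm{lub}(A)=\lambda$ if $A$ is an unbounded subset of a limit ordinal $\lambda$). An ultrafilter is ${<}\nu$-closed if it is closed under intersections of fewer than $\nu$ many of its elements. *)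

(* Defs.v *)
(** "We work in ZFC" is rendered semantically: [V] with its relation [∈] is an
    arbitrary model of first-order ZFC, the two schemas ranging over all
    formulas of the language of set theory with parameters.  All other notions
    are built from [∈], equality, connectives and quantifiers over [V] only, so
    they are first-order and are evaluated inside [V], which need not be
    well-founded from the outside.  There are no term constructors: [is_foo x a]
    reads "x is the foo of a". *)

Class Membership (V : Type) := mem : V -> V -> Prop.

Declare Scope zfc_scope.
Delimit Scope zfc_scope with zfc.
Notation "x ∈ y" := (mem x y) (at level 70, no associativity) : zfc_scope.
Notation "x ∉ y" := (~ mem x y) (at level 70, no associativity) : zfc_scope.
Open Scope zfc_scope.

(** Variables are de Bruijn indices: [FAll] binds index 0. *)
Inductive formula : Type :=
| FMem (i j : nat)
| FEq (i j : nat)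
| FNot (p : formula)
| FAnd (p q : formula)
| FAll (p : formula).

Definition scons {V : Type} (x : V) (e : nat -> V) (n : nat) : V :=
  match n with O => x | S m => e m end.

Fixpoint sat {V : Type} {M : Membership V} (e : nat -> V) (p : formula) : Prop :=
  match p with
  | FMem i j => e i ∈ e j
  | FEq i j => e i = e j
  | FNot p => ~ sat e p
  | FAnd p q => sat e p /\ sat e q
  | FAll p => forall x, sat (scons x e) p
  end.

Record ZFC (V : Type) {M : Membership V} : Prop := {
  zfc_extensionality : forall x y : V, (forall z, z ∈ x <-> z ∈ y) -> x = y;
  zfc_foundation : forall x : V,
    (exists y, y ∈ x) -> exists y, y ∈ x /\ forall z, z ∈ y -> z ∉ x;
  zfc_pairing : forall x y : V, exists p, forall z, z ∈ p <-> z = x \/ z = y;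
  zfc_union : forall x : V, exists u, forall z, z ∈ u <-> exists y, y ∈ x /\ z ∈ y;
  zfc_power : forall x : V,
    exists p, forall z, z ∈ p <-> forall t, t ∈ z -> t ∈ x;
  zfc_infinity : exists w : V,
    (exists o, o ∈ w /\ forall z, z ∉ o) /\
    (forall x, x ∈ w -> exists s, s ∈ w /\ forall z, z ∈ s <-> z ∈ x \/ z = x);
  zfc_separation : forall (p : formula) (e : nat -> V) (a : V),
    exists b, forall x, x ∈ b <-> x ∈ a /\ sat (scons x e) p;
  zfc_replacement : forall (p : formula) (e : nat -> V) (a : V),
    (forall x, x ∈ a -> forall y y',
       sat (scons x (scons y e)) p -> sat (scons x (scons y' e)) p -> y = y') ->
    exists b, forall y, y ∈ b <-> exists x, x ∈ a /\ sat (scons x (scons y e)) p;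
  zfc_choice : forall a : V,
    (forall x, x ∈ a -> exists z, z ∈ x) ->
    (forall x y z, x ∈ a -> y ∈ a -> z ∈ x -> z ∈ y -> x = y) ->
    exists c, forall x, x ∈ a ->
      exists z, z ∈ x /\ z ∈ c /\ forall z', z' ∈ x -> z' ∈ c -> z' = z
}.

Section SetTheory.
Context {V : Type} {M : Membership V}.
Implicit Types (a b c f g p s w x y z : V).

Definition subset a b : Prop := forall x, x ∈ a -> x ∈ b.

Definition is_singleton s x : Prop := forall z, z ∈ s <-> z = x.

Definition is_unordered_pair s x y : Prop := forall z, z ∈ s <-> z = x \/ z = y.

(** Kuratowski's [{{x}, {x, y}}] *)
Definition is_pair p x y : Prop :=
  exists a b, is_singleton a x /\ is_unordered_pair b x y /\ is_unordered_pair p a b.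

(** [app f x y] : [f(x) = y] *)
Definition app f x y : Prop := exists p, p ∈ f /\ is_pair p x y.

Definition is_function f : Prop :=
  (forall p, p ∈ f -> exists x y, is_pair p x y) /\
  (forall x y y', app f x y -> app f x y' -> y = y').

Definition in_dom x f : Prop := exists y, app f x y.

Definition function_on f a : Prop :=
  is_function f /\ forall x, x ∈ a <-> in_dom x f.

Definition function_from_to f a b : Prop :=
  function_on f a /\ forall x y, app f x y -> y ∈ b.

Definition bijection f a b : Prop :=
  function_from_to f a b /\
  (forall x x' y, app f x y -> app f x' y -> x = x') /\
  (forall y, y ∈ b -> exists x, app f x y).

Definition equinumerous a b : Prop := exists f, bijection f a b.

Definition le a b : Prop := a ∈ b \/ a = b.

Definition transitive x : Prop := forall y, y ∈ x -> subset y x.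

Definition well_ordered_by_mem x : Prop :=
  (forall a, a ∈ x -> a ∉ a) /\
  (forall a b c, a ∈ x -> b ∈ x -> c ∈ x -> a ∈ b -> b ∈ c -> a ∈ c) /\
  (forall a b, a ∈ x -> b ∈ x -> a ∈ b \/ a = b \/ b ∈ a) /\
  (forall s, subset s x -> (exists a, a ∈ s) ->
     exists m, m ∈ s /\ forall a, a ∈ s -> le m a).

Definition ordinal x : Prop := transitive x /\ well_ordered_by_mem x.

Definition is_succ s a : Prop := forall z, z ∈ s <-> z ∈ a \/ z = a.

(** 0 is not counted as a limit ordinal. *)
Definition limit_ordinal x : Prop :=
  ordinal x /\ (exists a, a ∈ x) /\ ~ (exists a, is_succ x a).

Definition is_omega w : Prop :=
  limit_ordinal w /\ forall a, a ∈ w -> ~ limit_ordinal a.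

Definition cardinal x : Prop :=
  ordinal x /\ forall a, a ∈ x -> ~ equinumerous a x.

Definition infinite_cardinal x : Prop :=
  cardinal x /\ exists w, is_omega w /\ le w x.

Definition uncountable_cardinal x : Prop :=
  cardinal x /\ exists w, is_omega w /\ w ∈ x.

Definition is_cardinality c x : Prop := cardinal c /\ equinumerous x c.

(** the cardinal [a^+] *)
Definition is_card_succ s a : Prop :=
  cardinal s /\ a ∈ s /\ forall c, cardinal c -> a ∈ c -> le s c.

(** the cardinal [2^a], as the cardinality of the power set of [a] *)
Definition is_two_pow c a : Prop :=
  exists p, (forall z, z ∈ p <-> subset z a) /\ is_cardinality c p.

(** For cardinals [n], this says that [x] has cardinality less than [n]. *)
Definition smaller x n : Prop := exists m, m ∈ n /\ equinumerous x m.

Definition unbounded_in a l : Prop :=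
  subset a l /\ forall x, x ∈ l -> exists y, y ∈ a /\ le x y.

Definition cobounded_in a l : Prop :=
  subset a l /\ exists x, x ∈ l /\ forall y, y ∈ l -> le x y -> y ∈ a.

Definition cofinal_map f a l : Prop :=
  function_from_to f a l /\
  forall x, x ∈ l -> exists i y, app f i y /\ le x y.

Definition is_cof k l : Prop :=
  ordinal k /\ (exists f, cofinal_map f k l) /\
  forall m, m ∈ k -> ~ exists f, cofinal_map f m l.

Definition regular_cardinal k : Prop := infinite_cardinal k /\ is_cof k k.

(** Filters are proper. *)
Definition filter s U : Prop :=
  (forall x, x ∈ U -> subset x s) /\
  s ∈ U /\
  (forall x, x ∈ U -> exists z, z ∈ x) /\
  (forall x y, x ∈ U -> subset x y -> subset y s -> y ∈ U) /\
  (forall x y z, x ∈ U -> y ∈ U -> (forall t, t ∈ z <-> t ∈ x /\ t ∈ y) -> z ∈ U).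

Definition ultrafilter s U : Prop :=
  filter s U /\
  forall x y, subset x s -> (forall t, t ∈ y <-> t ∈ s /\ t ∉ x) -> x ∈ U \/ y ∈ U.

(** [U], a filter on [s], is [<n]-closed; the intersection is relative to [s]. *)
Definition closed_below n s U : Prop :=
  forall g i, subset g U -> smaller g n ->
    (forall t, t ∈ i <-> t ∈ s /\ forall x, x ∈ g -> t ∈ x) -> i ∈ U.

Definition nonprincipal s U : Prop :=
  forall a x, a ∈ s -> is_singleton x a -> x ∉ U.

Definition measurable d : Prop :=
  uncountable_cardinal d /\
  exists U, ultrafilter d U /\ nonprincipal d U /\ closed_below d d U.

(** The last clause is closure under diagonal intersections of sequences
    [h : d -> U]. *)
Definition normal_ultrafilter d U : Prop :=
  ultrafilter d U /\ nonprincipal d U /\ closed_below d d U /\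
  forall h D, function_from_to h d U ->
    (forall b, b ∈ D <-> b ∈ d /\ forall a x, a ∈ b -> app h a x -> b ∈ x) ->
    D ∈ U.

(** [k] is uncountable and [k → (k)^2_2].  A 2-colouring of the two-element
    subsets of [k] is given by the set [c] of the pairs of the first colour. *)
Definition weakly_compact k : Prop :=
  uncountable_cardinal k /\
  forall c, exists H, subset H k /\ equinumerous H k /\
    ((forall x y p, x ∈ H -> y ∈ H -> x <> y -> is_unordered_pair p x y -> p ∈ c) \/
     (forall x y p, x ∈ H -> y ∈ H -> x <> y -> is_unordered_pair p x y -> p ∉ c)).

Definition strongly_compact k : Prop :=
  uncountable_cardinal k /\ regular_cardinal k /\
  forall s F, filter s F -> closed_below k s F ->
    exists U, subset F U /\ ultrafilter s U /\ closed_below k s U.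

(** For functions [f], [g] on [d]: [{a < d | f(a) = g(a)} ∈ U] and
    [{a < d | f(a) ∈ g(a)} ∈ U]. *)
Definition ult_eq d U f g : Prop :=
  exists x, x ∈ U /\
    forall a, a ∈ x <-> a ∈ d /\ exists y, app f a y /\ app g a y.

Definition ult_mem d U f g : Prop :=
  exists x, x ∈ U /\
    forall a, a ∈ x <-> a ∈ d /\ exists y z, app f a y /\ app g a z /\ y ∈ z.

(** The collapsing map [π([f]) = {π([g]) | [g] ∈_U [f]}] is a proper class, so
    it is obtained from its set approximations.  A partial collapse is a set
    function [p], [p(f) = π([f])], on a set of representatives [f : d -> V]
    that contains, up to [ult_eq], every [ult_mem]-predecessor of each of its
    members.  Working with representatives instead of equivalence classes
    (which are proper classes) does not change the collapse. *)
Definition partial_collapse d U p : Prop :=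
  is_function p /\
  (forall f, in_dom f p -> function_on f d) /\
  (forall f g, in_dom f p -> function_on g d -> ult_mem d U g f ->
     exists g', in_dom g' p /\ ult_eq d U g g') /\
  (forall f x, app p f x ->
     forall y, y ∈ x <-> exists g, ult_mem d U g f /\ app p g y).

(** the class [Ult(V,U)], the range of [π] *)
Definition Ult d U (x : V) : Prop :=
  exists p f, partial_collapse d U p /\ app p f x.

Definition is_lub l A : Prop :=
  ordinal l /\ (forall a, a ∈ A -> le a l) /\
  forall b, ordinal b -> (forall a, a ∈ A -> le a b) -> le l b.

Definition fresh (C : V -> Prop) A : Prop :=
  (forall a, a ∈ A -> ordinal a) /\
  ~ C A /\
  exists l, is_lub l A /\
    forall a, a ∈ l -> exists b, (forall z, z ∈ b <-> z ∈ A /\ z ∈ a) /\ C b.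

Definition no_fresh_unbounded_subset (C : V -> Prop) l : Prop :=
  ~ exists A, unbounded_in A l /\ fresh C A.

End SetTheory.

(* Main.v *)
From Stdlib Require Import Arith Classical ClassicalEpsilon FunctionalExtensionality.
Require Import Defs.

(** Let [k] be the cofinality of [lam], let [d] be the measurable cardinal, and
    suppose that all proper initial segments of an unbounded [A ⊆ lam] belong to
    the ultrapower.  Then [A] is the union of an increasing sequence of [k] many
    initial segments, the segment with index [ξ] being represented by a function
    [f(ξ)] on [d].  To place [A] in the ultrapower it suffices to find one
    function [F] that lies above every [f(ξ)] almost everywhere, and such that
    every function that is a member of [F] almost everywhere is already a member
    of some [f(ξ)] almost everywhere: then [F] represents the union
    ([union_in_Ult]).

    If [k ≤ d], let [F(i)] be the union of the [f(ξ)(i)] with [ξ < i]; by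
    normality a member of [F] is a member of one fixed [f(ξ)]
    ([short_union_in_Ult]).

    If [k > d], let [D] be a family of subsets of [k] such that any [d] many
    members of [D] have unboundedly many common elements, and which decides the
    sets [Z(ξ,i) = {ζ | f(ξ)(i) ⊆ f(ζ)(i)}].  Let [F(i)] be the union of the
    [f(ξ)(i)] with [Z(ξ,i) ∈ D].  A member [h] of [F] satisfies
    [h(i) ∈ f(ξ)(i)] with [Z(ξ,i) ∈ D], where [ξ] depends on [i]; a common
    element [ζ] of these [d] many sets gives [h(i) ∈ f(ζ)(i)] for all [i].
    Conversely, a common element [ζ ≥ ξ] of the [d] many decisions about
    [Z(ξ,i)] shows, since [f(ξ) ⊆ f(ζ)] almost everywhere, that the decision is
    positive for almost all [i], hence [f(ξ) ⊆ F] almost everywhere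
    ([long_union_in_Ult]).

    An ultrafilter on [k] that contains the cobounded sets and is closed under
    [d] many intersections is such a [D].  Closure below [(2^d)^+] gives this by
    Cantor's theorem, and above a strongly compact cardinal the filter of
    cobounded sets extends to such an ultrafilter
    ([cobounded_filter_extends]).  If [k] is weakly compact, there are only [k]
    many sets to decide: colour pairs from [k] by the lexicographic order of
    their sequences of decisions.  Along a homogeneous set every decision
    stabilizes, and the sets that contain a tail of it form [D]
    ([weakly_compact_decides]).

    Everything takes place inside a model of first-order ZFC, so separation and
    replacement require definability of the classes in question.  The predicate
    [dfn] expresses it on the level of the metatheory and the tactic [definable]
    proves it.  Selecting the functions [f(ξ)] by the axiom of choice requires a
    set that contains representatives of all the segments; the functions from
    [d] to the power set of [lam] suffice ([pi_subset_ordinal]). *)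

(** * Definable classes *)

Fixpoint ren (r : nat -> nat) (p : formula) : formula :=
  match p with
  | FMem i j => FMem (r i) (r j)
  | FEq i j => FEq (r i) (r j)
  | FNot p => FNot (ren r p)
  | FAnd p q => FAnd (ren r p) (ren r q)
  | FAll p => FAll (ren (fun n => match n with O => O | S m => S (r m) end) p)
  end.

Section Definability.
Context {V : Type} {M : Membership V}.
Implicit Types (e : nat -> V) (P Q : (nat -> V) -> Prop) (t : (nat -> V) -> V).

Lemma sat_ren p : forall e r, sat e (ren r p) <-> sat (fun n => e (r n)) p.
Proof.
  induction p as [i j|i j|p IH|p IHp q IHq|p IH]; intros e r; simpl.
  - tauto.
  - tauto.
  - rewrite IH. tauto.
  - rewrite IHp, IHq. tauto.
  - split; intros H x; specialize (H x); rewrite IH in *;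
      (replace (scons x (fun n => e (r n)))
        with (fun n => scons x e match n with O => O | S m => S (r m) end) in *; [exact H|]);
      extensionality n; destruct n; reflexivity.
Qed.

Definition read (r : nat -> nat + V) e (k : nat) : V :=
  match r k with inl n => e n | inr v => v end.

(** The variables of a formula are mapped by [r] to variables of [P] or to
    parameters, so that definability with parameters is closed under
    conjunction and quantification without bookkeeping of parameter lists. *)
Definition dfn P : Prop := exists p r, forall e, sat (read r e) p <-> P e.

(** Definability of an operation through its graph, which allows terms to be
    substituted into definable classes. *)
Definition dterm t : Prop := dfn (fun e => e 0 = t (fun n => e (S n))).

Lemma dfn_ext P Q : (forall e, P e <-> Q e) -> dfn P -> dfn Q.
Proof.
  intros H (p & r & Hp). exists p, r. intros e. rewrite Hp. apply H.
Qed.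

Lemma dfn_ren (f : nat -> nat) P : dfn P -> dfn (fun e => P (fun n => e (f n))).
Proof.
  intros (p & r & Hp).
  exists p, (fun k => match r k with inl n => inl (f n) | inr v => inr v end).
  intros e. rewrite <- Hp.
  replace (read (fun k => match r k with inl n => inl (f n) | inr v => inr v end) e)
    with (read r (fun n => e (f n))); [tauto|].
  extensionality k. unfold read. destruct (r k); reflexivity.
Qed.

Lemma dfn_not P : dfn P -> dfn (fun e => ~ P e).
Proof.
  intros (p & r & Hp). exists (FNot p), r. intros e. simpl. rewrite Hp. tauto.
Qed.

Lemma dfn_and P Q : dfn P -> dfn Q -> dfn (fun e => P e /\ Q e).
Proof.
  intros (p & r & Hp) (q & s & Hq).
  set (t := fun k => if Nat.even k then r (Nat.div2 k) else s (Nat.div2 k)).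
  exists (FAnd (ren (fun k => 2 * k) p) (ren (fun k => S (2 * k)) q)), t.
  intros e. cbn [sat]. rewrite !sat_ren, <- Hp, <- Hq.
  replace (fun n => read t e (2 * n)) with (read r e).
  2:{ extensionality n. unfold read, t.
      rewrite Nat.even_mul, Nat.div2_double. reflexivity. }
  replace (fun n => read t e (S (2 * n))) with (read s e).
  2:{ extensionality n. unfold read, t.
      rewrite Nat.even_succ, Nat.odd_mul, Nat.div2_succ_double. reflexivity. }
  tauto.
Qed.

Lemma dfn_or P Q : dfn P -> dfn Q -> dfn (fun e => P e \/ Q e).
Proof.
  intros HP HQ.
  apply (dfn_ext (fun e => ~ (~ P e /\ ~ Q e))).
  - intros e. tauto.
  - apply dfn_not, dfn_and; apply dfn_not; assumption.
Qed.

Lemma dfn_imp P Q : dfn P -> dfn Q -> dfn (fun e => P e -> Q e).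
Proof.
  intros HP HQ.
  apply (dfn_ext (fun e => ~ (P e /\ ~ Q e))).
  - intros e. tauto.
  - apply dfn_not, dfn_and; [|apply dfn_not]; assumption.
Qed.

Lemma dfn_iff P Q : dfn P -> dfn Q -> dfn (fun e => P e <-> Q e).
Proof. intros HP HQ. apply dfn_and; apply dfn_imp; assumption. Qed.

Lemma dfn_all (P : V -> (nat -> V) -> Prop) :
  dfn (fun e => P (e 0) (fun n => e (S n))) -> dfn (fun e => forall x, P x e).
Proof.
  intros (p & r & Hp).
  exists (FAll (ren (fun k => match r k with inl 0 => 0 | _ => S k end) p)),
    (fun k => match r k with inl (S n) => inl n | inl 0 => inl 0 | inr v => inr v end).
  intros e. cbn [sat].
  enough (H : forall x, sat (scons x (read
      (fun k => match r k with inl (S n) => inl n | inl 0 => inl 0 | inr v => inr v end) e))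
      (ren (fun k => match r k with inl 0 => 0 | _ => S k end) p) <-> P x e).
  { split; intros H' x; apply H, H'. }
  intros x. rewrite sat_ren.
  specialize (Hp (scons x e)). cbn in Hp. rewrite <- Hp.
  match goal with |- sat ?a _ <-> sat ?b _ => replace a with b; [tauto|] end.
  extensionality k. unfold read. destruct (r k) as [[|n]|v] eqn:E; simpl; rewrite ?E; reflexivity.
Qed.

Lemma dfn_ex (P : V -> (nat -> V) -> Prop) :
  dfn (fun e => P (e 0) (fun n => e (S n))) -> dfn (fun e => exists x, P x e).
Proof.
  intros H.
  apply (dfn_ext (fun e => ~ forall x, ~ P x e)).
  - intros e. split.
    + apply not_all_not_ex.
    + intros [x Hx] Hn. exact (Hn x Hx).
  - apply dfn_not, (dfn_all (fun x e => ~ P x e)), dfn_not, H.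
Qed.

Lemma dfn_subst (P : V -> (nat -> V) -> Prop) t :
  dfn (fun e => P (e 0) (fun n => e (S n))) -> dterm t -> dfn (fun e => P (t e) e).
Proof.
  intros HP Ht.
  apply (dfn_ext (fun e => exists x, x = t e /\ P x e)).
  - intros e. split.
    + intros (x & -> & H). exact H.
    + intros H. exists (t e). auto.
  - apply (dfn_ex (fun x e => x = t e /\ P x e)), dfn_and; assumption.
Qed.

Lemma dterm_ren (f : nat -> nat) t : dterm t -> dterm (fun e => t (fun n => e (f n))).
Proof.
  intros H. unfold dterm.
  exact (dfn_ren (fun n => match n with O => O | S m => S (f m) end) _ H).
Qed.

Lemma dterm_var n : dterm (fun e => e n).
Proof. exists (FEq 0 (S n)), inl. intros e. reflexivity. Qed.

Lemma dterm_const v : dterm (fun _ => v).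
Proof.
  exists (FEq 0 1), (fun k => match k with 0 => inl 0 | _ => inr v end).
  intros e. reflexivity.
Qed.

Lemma dfn_subst1 (R : V -> Prop) t :
  dfn (fun e => R (e 0)) -> dterm t -> dfn (fun e => R (t e)).
Proof. intros HR. apply (dfn_subst (fun x _ => R x)), HR. Qed.

Lemma dfn_subst2 (R : V -> V -> Prop) t u :
  dfn (fun e => R (e 0) (e 1)) -> dterm t -> dterm u -> dfn (fun e => R (t e) (u e)).
Proof.
  intros HR Ht Hu.
  apply (dfn_subst (fun x e => R (t e) x)); [|exact Hu].
  apply (dfn_subst (fun x e => R x (e 0))); [exact HR|].
  apply (dterm_ren S), Ht.
Qed.

Lemma dfn_subst3 (R : V -> V -> V -> Prop) t u v :
  dfn (fun e => R (e 0) (e 1) (e 2)) ->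
  dterm t -> dterm u -> dterm v -> dfn (fun e => R (t e) (u e) (v e)).
Proof.
  intros HR Ht Hu Hv.
  apply (dfn_subst (fun x e => R (t e) (u e) x)); [|exact Hv].
  apply (dfn_subst (fun x e => R (t (fun n => e (S n))) x (e 0)));
    [|apply (dterm_ren S), Hu].
  apply (dfn_subst (fun x e => R x (e 0) (e 1))); [exact HR|].
  apply (dterm_ren (fun n => S (S n))), Ht.
Qed.

Lemma dterm_subst1 (F : V -> V) t :
  dterm (fun e => F (e 0)) -> dterm t -> dterm (fun e => F (t e)).
Proof.
  intros HF Ht.
  apply (dfn_subst2 (fun x y => x = F y)); [|apply dterm_var|apply (dterm_ren S), Ht].
  exact HF.
Qed.

Lemma dterm_subst2 (F : V -> V -> V) t u :
  dterm (fun e => F (e 0) (e 1)) -> dterm t -> dterm u -> dterm (fun e => F (t e) (u e)).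
Proof.
  intros HF Ht Hu.
  apply (dfn_subst3 (fun x y z => x = F y z));
    [exact HF|apply dterm_var|apply (dterm_ren S), Ht|apply (dterm_ren S), Hu].
Qed.

Lemma dfn_mem t u : dterm t -> dterm u -> dfn (fun e => t e ∈ u e).
Proof.
  apply (dfn_subst2 (fun x y => x ∈ y)).
  exists (FMem 0 1), inl. intros e. reflexivity.
Qed.

Lemma dfn_eq t u : dterm t -> dterm u -> dfn (fun e => t e = u e).
Proof.
  apply (dfn_subst2 (fun x y => x = y)).
  exists (FEq 0 1), inl. intros e. reflexivity.
Qed.

Lemma dfn_False : dfn (fun _ => False).
Proof.
  exists (FNot (FEq 0 0)), inl. intros e. simpl. tauto.
Qed.

(** The form in which the separation schema takes a definable class. *)
Lemma dfn_unary (R : V -> Prop) (v : V) : dfn (fun e => R (e 0)) ->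
  exists p e, forall x, sat (scons x e) p <-> R x.
Proof.
  intros (p & r & Hp).
  exists (ren (fun k => match r k with inl 0 => 0 | _ => S k end) p),
    (fun k => match r k with inl _ => v | inr w => w end).
  intros x. rewrite sat_ren, <- (Hp (scons x (fun _ => v))).
  match goal with |- sat ?a _ <-> sat ?b _ => replace a with b; [tauto|] end.
  extensionality k. unfold read. destruct (r k) as [[|n]|w] eqn:E; simpl; rewrite ?E; reflexivity.
Qed.

(** The form in which the replacement schema takes a definable relation. *)
Lemma dfn_binary (R : V -> V -> Prop) (v : V) : dfn (fun e => R (e 0) (e 1)) ->
  exists p e, forall x y, sat (scons x (scons y e)) p <-> R x y.
Proof.
  intros (p & r & Hp).
  exists (ren (fun k => match r k with inl 0 => 0 | inl 1 => 1 | _ => S (S k) end) p),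
    (fun k => match r k with inl _ => v | inr w => w end).
  intros x y. rewrite sat_ren, <- (Hp (scons x (scons y (fun _ => v)))).
  match goal with |- sat ?a _ <-> sat ?b _ => replace a with b; [tauto|] end.
  extensionality k. unfold read.
  destruct (r k) as [[|[|n]]|w] eqn:E; simpl; rewrite ?E; reflexivity.
Qed.

Definition dfn1 (R : V -> Prop) : Prop := dfn (fun e => R (e 0)).
Definition dfn2 (R : V -> V -> Prop) : Prop := dfn (fun e => R (e 0) (e 1)).
Definition dfn3 (R : V -> V -> V -> Prop) : Prop := dfn (fun e => R (e 0) (e 1) (e 2)).
Definition dterm1 (F : V -> V) : Prop := dterm (fun e => F (e 0)).
Definition dterm2 (F : V -> V -> V) : Prop := dterm (fun e => F (e 0) (e 1)).

End Definability.

Ltac definable_named := fail.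

(** Decides definability by recursion on the syntax of a statement.  Named
    notions with a registered lemma are handled by [definable_named]; all
    others are unfolded down to their logical symbols. *)
Ltac definable :=
  try unfold dfn1, dfn2, dfn3, dterm1, dterm2; cbn beta;
  lazymatch goal with
  | |- dfn (fun e => _ /\ _) => apply dfn_and; definable
  | |- dfn (fun e => _ \/ _) => apply dfn_or; definable
  | |- dfn (fun e => ~ _) => apply dfn_not; definable
  | |- dfn (fun e => _ <-> _) => apply dfn_iff; definable
  | |- dfn (fun e => ex _) => apply dfn_ex; definable
  | |- dfn (fun e => False) => apply dfn_False
  | |- dfn (fun e => mem _ _) => apply dfn_mem; definable
  | |- dfn (fun e => _ = _) => apply dfn_eq; definable
  | |- _ =>
      first
        [ apply dterm_var
        | apply dterm_const
        | match goal with
          | H : dfn1 ?R |- dfn (fun e => ?R _) => apply (dfn_subst1 R _ H)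
          | H : dfn2 ?R |- dfn (fun e => ?R _ _) => apply (dfn_subst2 R _ _ H)
          | H : dfn3 ?R |- dfn (fun e => ?R _ _ _) => apply (dfn_subst3 R _ _ _ H)
          | H : dterm1 ?F |- dterm (fun e => ?F _) => apply (dterm_subst1 F _ H)
          | H : dterm2 ?F |- dterm (fun e => ?F _ _) => apply (dterm_subst2 F _ _ H)
          end; definable
        | definable_named; definable
        | apply dfn_imp; definable
        | apply dfn_all; definable
        | apply dfn_and; definable | apply dfn_or; definable
        | apply dfn_ex; definable ]
  end.

(** * Elementary set theory *)

Existing Class ZFC.

Section Operations.
Context {V : Type} {M : Membership V} {HV : ZFC V}.
Implicit Types (a b f g p s x y z : V) (P : V -> Prop) (F : V -> V).

Lemma set_ext a b : (forall x, x ∈ a <-> x ∈ b) -> a = b.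
Proof. apply (zfc_extensionality V HV). Qed.

Lemma inhabited_universe : inhabited V.
Proof. destruct (zfc_infinity V HV) as [w _]. exact (inhabits w). Qed.

Definition describes P y : Prop :=
  (P y /\ forall z, P z -> z = y) \/
  (~ (exists x, P x /\ forall z, P z -> z = x) /\ forall z, z ∉ y).

(** Definite description.  The value is the empty set when [P] has no unique
    witness, so that [the] preserves definability. *)
Definition the P : V := epsilon inhabited_universe (describes P).

Lemma exists_sep a P : dfn1 P -> exists b, forall x, x ∈ b <-> x ∈ a /\ P x.
Proof.
  intros HP. destruct (dfn_unary P a HP) as (p & e & H).
  destruct (zfc_separation V HV p e a) as [b Hb].
  exists b. intros x. rewrite Hb, H. tauto.
Qed.

Lemma the_describes P : describes P (the P).
Proof.
  unfold the. apply epsilon_spec.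
  destruct (classic (exists x, P x /\ forall z, P z -> z = x)) as [(x & Hx)|Hn].
  - exists x. left. exact Hx.
  - destruct (zfc_infinity V HV) as (w & (o & _ & Ho) & _).
    exists o. right. auto.
Qed.

Lemma describes_unique P x y : describes P x -> describes P y -> x = y.
Proof.
  intros [[Hx Ux]|[Nx Ex]] [[Hy Uy]|[Ny Ey]].
  - apply Uy, Hx.
  - exfalso. eauto.
  - exfalso. eauto.
  - apply set_ext. intros z. specialize (Ex z). specialize (Ey z). tauto.
Qed.

Lemma the_eq P y : P y -> (forall z, P z -> z = y) -> the P = y.
Proof.
  intros Hy Hu. apply (describes_unique P); [apply the_describes|]. left. auto.
Qed.

Lemma the_spec P : (exists y, P y) -> (forall y z, P y -> P z -> y = z) -> P (the P).
Proof.
  intros [y Hy] Hu. rewrite (the_eq P y); auto.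
Qed.

Lemma dterm_the (P : V -> (nat -> V) -> Prop) :
  dfn (fun e => P (e 0) (fun n => e (S n))) -> dterm (fun e => the (fun y => P y e)).
Proof.
  intros HP.
  assert (HP' : dfn (fun e => P (e 0) (fun n => e (S (S n)))))
    by exact (dfn_ren (fun n => match n with O => O | S m => S (S m) end) _ HP).
  assert (HP'' : dfn (fun e => P (e 0) (fun n => e (S (S (S n))))))
    by exact (dfn_ren (fun n => match n with O => O | S m => S (S (S m)) end) _ HP).
  apply (dfn_ext (fun e => describes (fun y => P y (fun n => e (S n))) (e 0))).
  - intros e. split.
    + intros H. apply (describes_unique _ _ _ H), the_describes.
    + intros ->. apply the_describes.
  - unfold describes. apply dfn_or; apply dfn_and.
    + exact HP.
    + apply (dfn_all (fun z e => P z (fun n => e (S n)) -> z = e 0)).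
      apply dfn_imp; [exact HP'|definable].
    + apply dfn_not.
      apply (dfn_ex (fun x e => P x (fun n => e (S n)) /\
        forall z, P z (fun n => e (S n)) -> z = x)).
      apply dfn_and; [exact HP'|].
      apply (dfn_all (fun z e => P z (fun n => e (S (S n))) -> z = e 0)).
      apply dfn_imp; [exact HP''|definable].
    + definable.
Qed.

Lemma not_subset_ex a b : ~ subset a b -> exists x, x ∈ a /\ x ∉ b.
Proof.
  intros Hn. apply NNPP. intros Hn'. apply Hn. intros x Hx. apply NNPP. eauto.
Qed.

Definition sep a P : V := the (fun b => forall x, x ∈ b <-> x ∈ a /\ P x).

Lemma in_sep a P x : dfn1 P -> x ∈ sep a P <-> x ∈ a /\ P x.
Proof.
  intros HP. revert x. apply (the_spec (fun b => forall x, x ∈ b <-> x ∈ a /\ P x)).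
  - apply exists_sep, HP.
  - intros y z Hy Hz. apply set_ext. intros x. rewrite Hy, Hz. tauto.
Qed.

Lemma dterm_sep (t : (nat -> V) -> V) (P : V -> (nat -> V) -> Prop) :
  dterm t -> dfn (fun e => P (e 0) (fun n => e (S n))) ->
  dterm (fun e => sep (t e) (fun x => P x e)).
Proof.
  intros Ht HP. unfold sep.
  apply (dterm_the (fun b e => forall x, x ∈ b <-> x ∈ t e /\ P x e)).
  apply (dfn_all (fun x e => x ∈ e 0 <-> x ∈ t (fun n => e (S n)) /\ P x (fun n => e (S n)))).
  apply dfn_iff; [definable|]. apply dfn_and.
  - apply dfn_mem; [definable|]. apply (dterm_ren (fun n => S (S n))), Ht.
  - exact (dfn_ren (fun n => match n with O => O | S m => S (S m) end) _ HP).
Qed.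

Definition img a F : V := the (fun b => forall y, y ∈ b <-> exists x, x ∈ a /\ y = F x).

Lemma in_img a F y : dterm1 F -> y ∈ img a F <-> exists x, x ∈ a /\ y = F x.
Proof.
  intros HF. revert y.
  apply (the_spec (fun b => forall y, y ∈ b <-> exists x, x ∈ a /\ y = F x)).
  - destruct (dfn_binary (fun x y => y = F x) a) as (p & e & H); [definable|].
    destruct (zfc_replacement V HV p e a) as [b Hb].
    + intros x _ y y'. rewrite !H. congruence.
    + exists b. intros y. rewrite Hb.
      split; intros (x & Hx & Hy); exists x; [rewrite H in Hy|rewrite H]; auto.
  - intros y z Hy Hz. apply set_ext. intros x. rewrite Hy, Hz. tauto.
Qed.

Lemma in_img_intro a F x : dterm1 F -> x ∈ a -> F x ∈ img a F.
Proof. intros HF Hx. apply in_img; eauto. Qed.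

Lemma dterm_img (t : (nat -> V) -> V) (F : V -> (nat -> V) -> V) :
  dterm t -> dterm (fun e => F (e 0) (fun n => e (S n))) ->
  dterm (fun e => img (t e) (fun x => F x e)).
Proof.
  intros Ht HF. unfold img.
  apply (dterm_the (fun b e => forall y, y ∈ b <-> exists x, x ∈ t e /\ y = F x e)).
  apply (dfn_all (fun y e => y ∈ e 0 <->
    exists x, x ∈ t (fun n => e (S n)) /\ y = F x (fun n => e (S n)))).
  apply dfn_iff; [definable|].
  apply (dfn_ex (fun x e => x ∈ t (fun n => e (S (S n))) /\ e 0 = F x (fun n => e (S (S n))))).
  apply dfn_and.
  - apply dfn_mem; [definable|]. apply (dterm_ren (fun n => S (S (S n)))), Ht.
  - apply dfn_eq; [definable|].
    exact (dterm_ren (fun n => match n with O => O | S m => S (S (S m)) end) _ HF).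
Qed.

Definition upair x y : V := the (fun p => is_unordered_pair p x y).

Lemma upair_spec x y : is_unordered_pair (upair x y) x y.
Proof.
  apply (the_spec (fun p => is_unordered_pair p x y)).
  - apply (zfc_pairing V HV).
  - intros p q Hp Hq. apply set_ext. intros z. rewrite (Hp z), (Hq z). tauto.
Qed.

Lemma in_upair x y z : z ∈ upair x y <-> z = x \/ z = y.
Proof. apply upair_spec. Qed.

Lemma dterm_upair t u : dterm t -> dterm u -> dterm (fun e => upair (t e) (u e)).
Proof.
  apply (dterm_subst2 upair). apply (dterm_the (fun p e => is_unordered_pair p (e 0) (e 1))).
  definable.
Qed.

Definition bigcup a : V := the (fun b => forall z, z ∈ b <-> exists y, y ∈ a /\ z ∈ y).

Lemma in_bigcup a z : z ∈ bigcup a <-> exists y, y ∈ a /\ z ∈ y.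
Proof.
  revert z. apply (the_spec (fun b => forall z, z ∈ b <-> exists y, y ∈ a /\ z ∈ y)).
  - apply (zfc_union V HV).
  - intros p q Hp Hq. apply set_ext. intros z. rewrite (Hp z), (Hq z). tauto.
Qed.

Lemma dterm_bigcup t : dterm t -> dterm (fun e => bigcup (t e)).
Proof.
  apply (dterm_subst1 bigcup).
  apply (dterm_the (fun b e => forall z, z ∈ b <-> exists y, y ∈ e 0 /\ z ∈ y)).
  definable.
Qed.

Definition cup a b : V := bigcup (upair a b).

Lemma in_cup a b z : z ∈ cup a b <-> z ∈ a \/ z ∈ b.
Proof.
  unfold cup. rewrite in_bigcup. split.
  - intros (y & Hy & Hz). rewrite in_upair in Hy. destruct Hy as [->| ->]; auto.
  - intros [H|H]; [exists a|exists b]; rewrite in_upair; auto.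
Qed.

Lemma dterm_cup t u : dterm t -> dterm u -> dterm (fun e => cup (t e) (u e)).
Proof. intros Ht Hu. apply dterm_bigcup, dterm_upair; assumption. Qed.

Definition power a : V := the (fun p => forall z, z ∈ p <-> subset z a).

Lemma in_power a z : z ∈ power a <-> subset z a.
Proof.
  revert z. apply (the_spec (fun p => forall z, z ∈ p <-> subset z a)).
  - apply (zfc_power V HV).
  - intros p q Hp Hq. apply set_ext. intros z. rewrite (Hp z), (Hq z). tauto.
Qed.

Lemma dterm_power t : dterm t -> dterm (fun e => power (t e)).
Proof.
  apply (dterm_subst1 power).
  apply (dterm_the (fun p e => forall z, z ∈ p <-> subset z (e 0))).
  definable.
Qed.

Definition sing x : V := upair x x.

Lemma in_sing x z : z ∈ sing x <-> z = x.
Proof. unfold sing. rewrite in_upair. tauto. Qed.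

Lemma dterm_sing t : dterm t -> dterm (fun e => sing (t e)).
Proof. intros H. apply dterm_upair; assumption. Qed.

Definition pr x y : V := upair (sing x) (upair x y).

Lemma dterm_pr t u : dterm t -> dterm u -> dterm (fun e => pr (t e) (u e)).
Proof. intros. repeat apply dterm_upair; assumption. Qed.

Lemma is_pair_pr p x y : is_pair p x y <-> p = pr x y.
Proof.
  split.
  - intros (a & b & Ha & Hb & Hp). apply set_ext. intros z.
    assert (Ea : a = sing x) by (apply set_ext; intros t; rewrite (Ha t), in_sing; tauto).
    assert (Eb : b = upair x y) by (apply set_ext; intros t; rewrite (Hb t), in_upair; tauto).
    unfold pr. rewrite (Hp z), in_upair, Ea, Eb. tauto.
  - intros ->. exists (sing x), (upair x y). split; [|split].
    + intros z. apply in_sing.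
    + apply upair_spec.
    + apply upair_spec.
Qed.

Lemma pr_inj x y x' y' : pr x y = pr x' y' -> x = x' /\ y = y'.
Proof.
  intros E.
  assert (H : forall z, z = sing x \/ z = upair x y <-> z = sing x' \/ z = upair x' y').
  { intros z. rewrite <- !in_upair. change (z ∈ pr x y <-> z ∈ pr x' y'). rewrite E. tauto. }
  assert (Hx : x = x').
  { destruct (proj1 (H (sing x)) (or_introl eq_refl)) as [E1|E1].
    - apply in_sing. rewrite <- E1. apply in_sing. reflexivity.
    - symmetry. apply in_sing. rewrite E1. apply in_upair. auto. }
  subst x'. split; [reflexivity|].
  assert (Hy : y = x \/ y = y').
  { destruct (proj1 (H (upair x y)) (or_intror eq_refl)) as [E1|E1].
    - left. apply in_sing. rewrite <- E1. apply in_upair. auto.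
    - apply in_upair. rewrite <- E1. apply in_upair. auto. }
  destruct Hy as [->|]; [|assumption].
  destruct (proj2 (H (upair x y')) (or_intror eq_refl)) as [E1|E1].
  - symmetry. apply in_sing. rewrite <- E1. apply in_upair. auto.
  - assert (y' ∈ upair x x) as Hy' by (rewrite <- E1; apply in_upair; auto).
    apply in_upair in Hy'. symmetry. tauto.
Qed.

Lemma app_pr f x y : app f x y <-> pr x y ∈ f.
Proof.
  unfold app. split.
  - intros (p & Hp & E). apply is_pair_pr in E. subst. exact Hp.
  - intros H. exists (pr x y). split; [exact H|]. apply is_pair_pr. reflexivity.
Qed.

Lemma dfn_app t u v : dterm t -> dterm u -> dterm v -> dfn (fun e => app (t e) (u e) (v e)).
Proof. apply (dfn_subst3 app). definable. Qed.

Definition ap f x : V := the (app f x).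

Lemma dterm_ap t u : dterm t -> dterm u -> dterm (fun e => ap (t e) (u e)).
Proof.
  apply (dterm_subst2 ap). apply (dterm_the (fun y e => app (e 0) (e 1) y)).
  apply dfn_app; definable.
Qed.

Definition lam a F : V := img a (fun x => pr x (F x)).

Lemma dterm_lam (t : (nat -> V) -> V) (F : V -> (nat -> V) -> V) :
  dterm t -> dterm (fun e => F (e 0) (fun n => e (S n))) ->
  dterm (fun e => lam (t e) (fun x => F x e)).
Proof.
  intros Ht HF. apply (dterm_img t (fun x e => pr x (F x e))); [exact Ht|].
  apply dterm_pr; [definable|exact HF].
Qed.

Definition prod a b : V := bigcup (img a (fun x => img b (pr x))).

Definition ite (P : Prop) x y : V := the (fun z => (P /\ z = x) \/ (~ P /\ z = y)).

Lemma ite_true (P : Prop) x y : P -> ite P x y = x.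
Proof. intros H. apply the_eq; tauto. Qed.

Lemma ite_false (P : Prop) x y : ~ P -> ite P x y = y.
Proof. intros H. apply the_eq; tauto. Qed.

Lemma dterm_ite (P : (nat -> V) -> Prop) t u :
  dfn P -> dterm t -> dterm u -> dterm (fun e => ite (P e) (t e) (u e)).
Proof.
  intros HP Ht Hu.
  apply (dterm_the (fun z e => (P e /\ z = t e) \/ (~ P e /\ z = u e))).
  apply (dfn_ren S) in HP.
  apply dfn_or; apply dfn_and;
    solve [exact HP | apply dfn_not, HP |
      apply dfn_eq; [definable | apply (dterm_ren S); assumption]].
Qed.

End Operations.

Ltac definable_operation :=
  lazymatch goal with
  | |- dterm (fun e => ap _ _) => apply dterm_ap
  | |- dterm (fun e => the _) => apply dterm_the
  | |- dterm (fun e => sep _ _) => apply dterm_sep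
  | |- dterm (fun e => img _ _) => apply dterm_img
  | |- dterm (fun e => lam _ _) => apply dterm_lam
  | |- dterm (fun e => upair _ _) => apply dterm_upair
  | |- dterm (fun e => bigcup _) => apply dterm_bigcup
  | |- dterm (fun e => cup _ _) => apply dterm_cup
  | |- dterm (fun e => power _) => apply dterm_power
  | |- dterm (fun e => sing _) => apply dterm_sing
  | |- dterm (fun e => pr _ _) => apply dterm_pr
  | |- dterm (fun e => ite _ _ _) => apply dterm_ite
  | |- dfn (fun e => app _ _ _) => apply dfn_app
  end.

Ltac definable_named ::= definable_operation.

Section Functions.
Context {V : Type} {M : Membership V} {HV : ZFC V}.
Implicit Types (a b f g p s x y z : V) (P : V -> Prop) (F : V -> V).

Lemma in_prod a b p : p ∈ prod a b <-> exists x y, x ∈ a /\ y ∈ b /\ p = pr x y.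
Proof.
  unfold prod. rewrite in_bigcup. split.
  - intros (t & Ht & Hp). apply in_img in Ht; [|definable].
    destruct Ht as (x & Hx & ->). apply in_img in Hp; [|definable].
    destruct Hp as (y & Hy & ->). eauto.
  - intros (x & y & Hx & Hy & ->). exists (img b (pr x)).
    split; [apply (in_img_intro a (fun x => img b (pr x)))|apply (in_img_intro b (pr x))];
      try definable; assumption.
Qed.

Lemma app_lam a F x y : dterm1 F -> app (lam a F) x y <-> x ∈ a /\ y = F x.
Proof.
  intros HF. rewrite app_pr. unfold lam. rewrite in_img by definable. split.
  - intros (z & Hz & E). apply pr_inj in E. destruct E as [-> ->]. auto.
  - intros [Hx ->]. eauto.
Qed.

Lemma function_on_lam a F : dterm1 F -> function_on (lam a F) a.
Proof.
  intros HF. split; [split|].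
  - intros p Hp. unfold lam in Hp. apply in_img in Hp; [|definable].
    destruct Hp as (x & _ & ->). exists x, (F x). apply is_pair_pr. reflexivity.
  - intros x y y'. rewrite !app_lam by assumption. intros [_ ->] [_ ->]. reflexivity.
  - intros x. split.
    + intros Hx. exists (F x). apply app_lam; auto.
    + intros [y Hy]. apply app_lam in Hy; tauto.
Qed.

Lemma app_ap_eq f x y : is_function f -> app f x y -> ap f x = y.
Proof.
  intros [_ Hf] H. apply the_eq; [exact H|]. intros z Hz. exact (Hf _ _ _ Hz H).
Qed.

Lemma app_ap f a x : function_on f a -> x ∈ a -> app f x (ap f x).
Proof.
  intros [Hf Hd] Hx. apply Hd in Hx. destruct Hx as [y Hy].
  rewrite (app_ap_eq f x y Hf Hy). exact Hy.
Qed.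

Lemma app_iff f a x y : function_on f a -> app f x y <-> x ∈ a /\ y = ap f x.
Proof.
  intros Hf. split.
  - intros H. split.
    + apply (proj2 Hf). exists y. exact H.
    + symmetry. apply app_ap_eq; [apply Hf|exact H].
  - intros [Hx ->]. apply (app_ap f a); assumption.
Qed.

Lemma ap_lam a F x : dterm1 F -> x ∈ a -> ap (lam a F) x = F x.
Proof.
  intros HF Hx. apply app_ap_eq; [apply (function_on_lam a F HF)|]. apply app_lam; auto.
Qed.

Lemma lam_ext a b F G : (forall x, x ∈ a <-> x ∈ b) -> (forall x, x ∈ a -> F x = G x) ->
  dterm1 F -> dterm1 G -> lam a F = lam b G.
Proof.
  intros Hab HFG HF HG. replace b with a by (apply set_ext, Hab).
  apply set_ext. intros p. unfold lam. rewrite !in_img by definable.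
  split; intros (x & Hx & ->); exists x; rewrite HFG by assumption; auto.
Qed.

Lemma function_from_to_lam a b F :
  dterm1 F -> (forall x, x ∈ a -> F x ∈ b) -> function_from_to (lam a F) a b.
Proof.
  intros HF H. split; [apply function_on_lam, HF|].
  intros x y Hxy. apply app_lam in Hxy; [|exact HF]. destruct Hxy as [Hx ->]. auto.
Qed.

Lemma function_from_to_iff f a b :
  function_from_to f a b <-> function_on f a /\ forall x, x ∈ a -> ap f x ∈ b.
Proof.
  split; intros [Hf H]; (split; [exact Hf|]).
  - intros x Hx. apply (H x). apply (app_ap f a); assumption.
  - intros x y Hxy. apply (app_iff f a) in Hxy; [|exact Hf]. destruct Hxy as [Hx ->]. auto.
Qed.

Lemma ap_in f a b x : function_from_to f a b -> x ∈ a -> ap f x ∈ b.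
Proof. intros H Hx. apply function_from_to_iff in H. apply H, Hx. Qed.

Definition funcs a b : V := sep (power (prod a b)) (fun f => function_from_to f a b).

Lemma in_funcs a b f : f ∈ funcs a b <-> function_from_to f a b.
Proof.
  unfold funcs. rewrite in_sep by definable. rewrite in_power. split; [tauto|].
  intros Hf. split; [|exact Hf]. intros p Hp.
  destruct (proj1 (proj1 (proj1 Hf)) p Hp) as (x & y & E). apply is_pair_pr in E. subst p.
  apply app_pr in Hp. apply in_prod. exists x, y. split; [|split]; [| |reflexivity].
  - apply (proj2 (proj1 Hf)). exists y. exact Hp.
  - apply (proj2 Hf) in Hp. exact Hp.
Qed.

(** Tagging the sets [{y ∈ b | R(x,y)}] with [x] makes them disjoint, as the
    axiom of choice requires. *)
Lemma choice_function a b (R : V -> V -> Prop) : dfn2 R ->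
  (forall x, x ∈ a -> exists y, y ∈ b /\ R x y) ->
  exists f, function_from_to f a b /\ forall x, x ∈ a -> R x (ap f x).
Proof.
  intros HR Hex.
  set (T := fun x => img (sep b (R x)) (pr x)).
  assert (inT : forall x p, p ∈ T x <-> exists y, y ∈ b /\ R x y /\ p = pr x y).
  { intros x p. unfold T. rewrite in_img by definable. split.
    - intros (y & Hy & ->). apply in_sep in Hy; [|definable]. exists y. tauto.
    - intros (y & Hy & HRy & ->). exists y. rewrite in_sep by definable. auto. }
  assert (HT : dterm1 T) by (unfold T; definable).
  destruct (zfc_choice V HV (img a T)) as [c Hc].
  - intros t Ht. apply in_img in Ht; [|exact HT]. destruct Ht as (x & Hx & ->).
    destruct (Hex x Hx) as (y & Hy & HRy). exists (pr x y). apply inT. eauto.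
  - intros t t' z Ht Ht' Hz Hz'. apply in_img in Ht, Ht'; try exact HT.
    destruct Ht as (x & Hx & ->). destruct Ht' as (x' & Hx' & ->).
    apply inT in Hz, Hz'. destruct Hz as (y & _ & _ & ->). destruct Hz' as (y' & _ & _ & E).
    apply pr_inj in E. destruct E as [-> _]. reflexivity.
  - assert (Hthe : forall x, x ∈ a ->
      let y := the (fun y => y ∈ b /\ R x y /\ pr x y ∈ c) in y ∈ b /\ R x y /\ pr x y ∈ c).
    { intros x Hx. apply the_spec.
      - destruct (Hc (T x)) as (p & Hp & Hpc & _); [apply in_img_intro; assumption|].
        apply inT in Hp. destruct Hp as (y & Hy & HRy & ->). exists y. auto.
      - intros y z (Hy & HRy & Hyc) (Hz & HRz & Hzc).
        destruct (Hc (T x)) as (p & Hp & Hpc & Hu); [apply in_img_intro; assumption|].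
        assert (pr x y = p) as E1 by (apply Hu; [apply inT; eauto|assumption]).
        assert (pr x z = p) as E2 by (apply Hu; [apply inT; eauto|assumption]).
        rewrite <- E2 in E1. apply pr_inj in E1. tauto. }
    exists (lam a (fun x => the (fun y => y ∈ b /\ R x y /\ pr x y ∈ c))). split.
    + apply function_from_to_lam; [definable|]. intros x Hx. apply (Hthe x Hx).
    + intros x Hx. rewrite ap_lam; [|definable|exact Hx]. apply (Hthe x Hx).
Qed.

(** ** Recursion *)

Definition well_founded_on (W : V) (R : V -> V -> Prop) : Prop :=
  forall s, subset s W -> (exists x, x ∈ s) -> exists m, m ∈ s /\ forall y, y ∈ s -> ~ R y m.

Lemma wf_induction W R (P : V -> Prop) : dfn1 P -> well_founded_on W R ->
  (forall x, x ∈ W -> (forall y, y ∈ W -> R y x -> P y) -> P x) -> forall x, x ∈ W -> P x.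
Proof.
  intros HP HR IH x Hx. apply NNPP. intros Hn.
  destruct (HR (sep W (fun y => ~ P y))) as (m & Hm & Hmin).
  - intros y Hy. apply in_sep in Hy; [tauto|definable].
  - exists x. apply in_sep; [definable|auto].
  - apply in_sep in Hm; [|definable]. destruct Hm as [HmW Hm]. apply Hm, IH; [exact HmW|].
    intros y Hy Hym. apply NNPP. intros HyP. apply (Hmin y); [|exact Hym].
    apply in_sep; [definable|auto].
Qed.

Section Recursion.
Variables (W : V) (R : V -> V -> Prop) (G : V -> V -> V).
Hypotheses (HR : dfn2 R) (HG : dterm2 G) (Hwf : well_founded_on W R).

Local Notation preds x := (sep W (fun y => R y x)).

Lemma in_preds x y : y ∈ preds x <-> y ∈ W /\ R y x.
Proof. apply (in_sep W (fun y => R y x)). definable. Qed.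

(** Initial parts of the function that is to be defined by recursion *)
Definition attempt (u : V) : Prop := exists D,
  subset D W /\ (forall x y, x ∈ D -> y ∈ preds x -> y ∈ D) /\ function_on u D /\
  forall x, x ∈ D -> ap u x = G x (lam (preds x) (ap u)).

Lemma attempt_agree u u' : attempt u -> attempt u' ->
  forall x, x ∈ W -> in_dom x u -> in_dom x u' -> ap u x = ap u' x.
Proof.
  intros (D & HDW & HD & Hu & E) (D' & HDW' & HD' & Hu' & E').
  apply (wf_induction W R (fun x => in_dom x u -> in_dom x u' -> ap u x = ap u' x));
    [definable|exact Hwf|].
  intros x Hx IH Hxu Hxu'. apply (proj2 Hu) in Hxu. apply (proj2 Hu') in Hxu'.
  rewrite E, E' by assumption. f_equal.
  apply lam_ext; [tauto| |definable|definable].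
  intros y Hy. apply IH.
  - apply in_preds in Hy. tauto.
  - apply in_preds in Hy. tauto.
  - apply (proj2 Hu). eauto.
  - apply (proj2 Hu'). eauto.
Qed.

(** Attempts agree wherever two of them are defined, so that together they form
    one attempt.  A minimal point outside its domain could be added to it. *)
Theorem wf_recursion : exists f, function_on f W /\
  forall x, x ∈ W -> ap f x = G x (lam (preds x) (ap f)).
Proof.
  assert (Hatt : dfn1 attempt) by (unfold attempt; definable).
  set (val := fun x => the (fun v => exists u, attempt u /\ app u x v)).
  assert (Hval : dterm1 val) by (unfold val; definable).
  assert (val_eq : forall u x, attempt u -> x ∈ W -> in_dom x u -> val x = ap u x).
  { intros u x Hu Hx Hxu.
    assert (Hux : app u x (ap u x)).
    { destruct Hu as (D & _ & _ & Hu & _). apply (app_ap u D); [exact Hu|].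
      apply (proj2 Hu), Hxu. }
    apply the_eq.
    - exists u. auto.
    - intros z (u' & Hu' & Hz).
      rewrite (attempt_agree u u' Hu Hu' x Hx Hxu); [|exists z; exact Hz].
      destruct Hu' as (D' & _ & _ & Hu' & _). symmetry. apply app_ap_eq; [apply Hu'|exact Hz]. }
  set (good := fun x => exists u, attempt u /\ in_dom x u).
  assert (Hgood : dfn1 good) by (unfold good; definable).
  assert (val_rec : forall x, x ∈ W -> good x -> val x = G x (lam (preds x) val)).
  { intros x Hx (u & Hu & Hxu). rewrite (val_eq u x Hu Hx Hxu).
    pose proof Hu as (D & HDW & HD & Hf & E).
    apply (proj2 Hf) in Hxu. rewrite E by exact Hxu. f_equal.
    apply lam_ext; [tauto| |definable|definable].
    intros y Hy. symmetry. apply val_eq; [exact Hu| |].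
    - apply in_preds in Hy. tauto.
    - apply (proj2 Hf). eauto. }
  assert (pred_good : forall x y, good x -> y ∈ preds x -> good y).
  { intros x y (u & Hu & Hxu) Hy. exists u. split; [exact Hu|].
    destruct Hu as (D & HDW & HD & Hf & E). apply (proj2 Hf). apply (proj2 Hf) in Hxu. eauto. }
  assert (all_good : forall x, x ∈ W -> good x).
  { apply (wf_induction W R good); [definable|exact Hwf|].
    intros x Hx IH.
    set (D := sep W (fun y => good y \/ y = x)).
    assert (inD : forall y, y ∈ D <-> y ∈ W /\ (good y \/ y = x))
      by (intros y; unfold D; rewrite in_sep by definable; tauto).
    assert (predD : forall y z, y ∈ D -> z ∈ preds y -> z ∈ W /\ good z).
    { intros y z Hy Hz. apply inD in Hy. split; [apply in_preds in Hz; tauto|].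
      destruct Hy as [_ [Hy| ->]]; [eauto|]. apply in_preds in Hz. apply IH; tauto. }
    set (u := lam D (fun y => G y (lam (preds y) val))).
    exists u. split.
    - exists D. split; [|split; [|split]].
      + intros y Hy. apply inD in Hy. tauto.
      + intros y z Hy Hz. apply inD. destruct (predD y z Hy Hz). auto.
      + apply function_on_lam. definable.
      + intros y Hy. unfold u at 1. rewrite ap_lam; [|definable|exact Hy]. f_equal.
        apply lam_ext; [tauto| |definable|definable].
        intros z Hz. destruct (predD y z Hy Hz) as [HzW Hzg]. unfold u.
        rewrite ap_lam; [|definable|apply inD; auto].
        apply val_rec; assumption.
    - exists (G x (lam (preds x) val)). apply app_lam; [definable|].
      split; [apply inD; auto|reflexivity]. }
  exists (lam W val). split; [apply function_on_lam, Hval|].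
  intros x Hx. rewrite ap_lam by assumption. rewrite val_rec by auto. f_equal.
  apply lam_ext; [tauto| |definable|definable].
  intros y Hy. apply in_preds in Hy. rewrite ap_lam; tauto.
Qed.

End Recursion.

End Functions.

(** * Foundation and ordinals *)

Section Ordinals.
Context {V : Type} {M : Membership V} {HV : ZFC V}.
Implicit Types (a b f g k l m n p s x y z : V) (P : V -> Prop) (F : V -> V).

Lemma wf_mem W : well_founded_on W (fun y x => y ∈ x).
Proof.
  intros s _ Hs. destruct (zfc_foundation V HV s Hs) as (m & Hm & H).
  exists m. split; [exact Hm|]. intros y Hy Hym. exact (H y Hym Hy).
Qed.

(** The union of [x], [⋃x], [⋃⋃x] and so on.  The recursion runs along the set
    provided by the axiom of infinity, where each stage is a member of a later
    one. *)
Lemma transitive_closure x : exists T, transitive T /\ subset x T.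
Proof.
  destruct (zfc_infinity V HV) as (w & (o & Ho & _) & Hs).
  destruct (wf_recursion w (fun y x => y ∈ x)
    (fun n u => cup x (bigcup (bigcup (img (sep w (fun m => m ∈ n)) (ap u))))))
    as (f & Hf & E); [definable|definable|apply wf_mem|].
  assert (in_f : forall n z, n ∈ w ->
    z ∈ ap f n <-> z ∈ x \/ exists m t, m ∈ w /\ m ∈ n /\ t ∈ ap f m /\ z ∈ t).
  { intros n z Hn. rewrite E by exact Hn. rewrite in_cup, in_bigcup.
    apply or_iff_compat_l. split.
    - intros (t & Ht & Hz). apply in_bigcup in Ht. destruct Ht as (v & Hv & Ht).
      apply in_img in Hv; [|definable]. destruct Hv as (m & Hm & ->).
      rewrite ap_lam in Ht; [|definable|exact Hm].
      apply in_sep in Hm; [|definable]. exists m, t. tauto.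
    - intros (m & t & Hm & Hmn & Ht & Hz). exists t. split; [|exact Hz].
      assert (Hm' : m ∈ sep w (fun y => y ∈ n)) by (apply in_sep; [definable|auto]).
      apply in_bigcup. exists (ap f m). split; [|exact Ht].
      apply in_img; [definable|]. exists m. split; [exact Hm'|].
      rewrite ap_lam; [reflexivity|definable|exact Hm']. }
  exists (bigcup (img w (ap f))). split.
  - intros t Ht z Hz. apply in_bigcup in Ht. destruct Ht as (v & Hv & Ht).
    apply in_img in Hv; [|definable]. destruct Hv as (m & Hm & ->).
    destruct (Hs m Hm) as (n & Hn & Hn'). apply in_bigcup. exists (ap f n). split.
    + apply in_img_intro; [definable|exact Hn].
    + apply in_f; [exact Hn|]. right. exists m, t. rewrite Hn'. auto.
  - intros z Hz. apply in_bigcup. exists (ap f o). split.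
    + apply in_img_intro; [definable|exact Ho].
    + apply in_f; auto.
Qed.

(** Foundation concerns sets only; a counterexample has a minimal one inside the
    transitive closure. *)
Lemma mem_induction P : dfn1 P -> (forall x, (forall y, y ∈ x -> P y) -> P x) -> forall x, P x.
Proof.
  intros HP IH x. apply IH. destruct (transitive_closure x) as (T & HT & HxT).
  intros y Hy. apply HxT in Hy. revert y Hy.
  apply (wf_induction T (fun y x => y ∈ x)); [exact HP|apply wf_mem|].
  intros y Hy Hrec. apply IH. intros z Hz. apply Hrec; [|exact Hz]. exact (HT y Hy z Hz).
Qed.

Lemma mem_irrefl x : x ∉ x.
Proof.
  revert x. apply (mem_induction (fun x => x ∉ x)); [definable|].
  intros x IH H. exact (IH x H H).
Qed.

Lemma ordinal_trans l a b : ordinal l -> a ∈ b -> b ∈ l -> a ∈ l.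
Proof. intros [H _] Ha Hb. exact (H b Hb a Ha). Qed.

Lemma transitive_subset_ordinal a l : ordinal l -> transitive a -> subset a l -> ordinal a.
Proof.
  intros (_ & H1 & H2 & H3 & H4) Ha Hal. split; [exact Ha|]. split; [|split; [|split]].
  - intros x Hx. apply H1, Hal, Hx.
  - intros x y z Hx Hy Hz. apply H2; auto.
  - intros x y Hx Hy. apply H3; auto.
  - intros s Hs. apply H4. intros x Hx. auto.
Qed.

Lemma ordinal_mem l a : ordinal l -> a ∈ l -> ordinal a.
Proof.
  intros Hl Ha. apply (transitive_subset_ordinal a l Hl).
  - intros x Hx y Hy. destruct Hl as (Ht & _ & H2 & _).
    pose proof (Ht a Ha x Hx) as Hxl.
    exact (H2 y x a (Ht x Hxl y Hy) Hxl Ha Hy Hx).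
  - apply (proj1 Hl a Ha).
Qed.

(** If [a] is not all of [l], then [a] is the least element of [l] outside [a]. *)
Lemma transitive_subset_le a l : ordinal l -> transitive a -> subset a l -> le a l.
Proof.
  intros Hl Ha Hal. destruct (classic (a = l)) as [->|Hne]; [right; reflexivity|left].
  set (s := sep l (fun x => x ∉ a)).
  assert (in_s : forall x, x ∈ s <-> x ∈ l /\ x ∉ a)
    by (intros x; unfold s; rewrite in_sep by definable; tauto).
  destruct (proj2 (proj2 (proj2 (proj2 Hl))) s) as (m & Hm & Hmin).
  - intros x Hx. apply in_s in Hx. tauto.
  - apply NNPP. intros Hn. apply Hne. apply set_ext. intros x. split; [apply Hal|].
    intros Hx. apply NNPP. intros Hxa. apply Hn. exists x. apply in_s. auto.
  - apply in_s in Hm. destruct Hm as [Hml Hma].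
    replace a with m; [exact Hml|]. apply set_ext. intros x. split.
    + intros Hx. apply NNPP. intros Hxa.
      assert (Hxs : x ∈ s) by (apply in_s; split; [exact (ordinal_trans l x m Hl Hx Hml)|exact Hxa]).
      destruct (Hmin x Hxs) as [H|H].
      * pose proof (ordinal_mem l m Hl Hml) as Hm.
        exact (mem_irrefl m (ordinal_trans m m x Hm H Hx)).
      * subst. exact (mem_irrefl x Hx).
    + intros Hx. pose proof (Hal x Hx) as Hxl.
      destruct (proj1 (proj2 (proj2 (proj2 Hl))) x m Hxl Hml) as [H|[H|H]].
      * exact H.
      * subst. contradiction.
      * exfalso. apply Hma. exact (Ha x Hx m H).
Qed.

Lemma le_subset a l : ordinal l -> le a l -> subset a l.
Proof. intros Hl [H| ->]; [apply (proj1 Hl a H)|intros x Hx; exact Hx]. Qed.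

(** The intersection [c] is an initial segment of both ordinals; if it were
    proper in both, it would be a member of itself. *)
Lemma ordinal_cases a b : ordinal a -> ordinal b -> a ∈ b \/ a = b \/ b ∈ a.
Proof.
  intros Ha Hb.
  set (c := sep a (fun x => x ∈ b)).
  assert (in_c : forall x, x ∈ c <-> x ∈ a /\ x ∈ b)
    by (intros x; unfold c; rewrite in_sep by definable; tauto).
  assert (Hc : transitive c).
  { intros x Hx y Hy. apply in_c in Hx. apply in_c.
    split; [apply (ordinal_trans a y x)|apply (ordinal_trans b y x)]; tauto. }
  assert (le c a) as [H1|H1]
    by (apply transitive_subset_le; [exact Ha|exact Hc|intros x Hx; apply in_c in Hx; tauto]);
  assert (le c b) as [H2|H2]
    by (apply transitive_subset_le; [exact Hb|exact Hc|intros x Hx; apply in_c in Hx; tauto]).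
  - exfalso. apply (mem_irrefl c), in_c. auto.
  - right. right. congruence.
  - left. congruence.
  - right. left. congruence.
Qed.

Lemma not_mem_le a b : ordinal a -> ordinal b -> a ∉ b -> le b a.
Proof. intros Ha Hb H. destruct (ordinal_cases a b Ha Hb) as [H'|[H'|H']]; [tauto|right; auto|left; auto]. Qed.

Lemma le_not_mem a b : ordinal b -> le a b -> b ∉ a.
Proof.
  intros Hb [H| ->]; [|apply mem_irrefl].
  intros H'. exact (mem_irrefl b (ordinal_trans b b a Hb H' H)).
Qed.

Lemma le_mem_trans a b l : ordinal l -> le a b -> b ∈ l -> a ∈ l.
Proof. intros Hl [H| ->] Hb; [exact (ordinal_trans l a b Hl H Hb)|exact Hb]. Qed.

Lemma le_trans a b l : ordinal l -> le a b -> le b l -> le a l.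
Proof. intros Hl H [Hb| <-]; [left; exact (le_mem_trans a b l Hl H Hb)|exact H]. Qed.

Lemma least_element s : (exists x, x ∈ s) -> (forall x, x ∈ s -> ordinal x) ->
  exists m, m ∈ s /\ forall x, x ∈ s -> le m x.
Proof.
  intros Hs Ho. destruct (wf_mem s s) as (m & Hm & Hmin); [intros x Hx; exact Hx|exact Hs|].
  exists m. split; [exact Hm|]. intros x Hx. apply not_mem_le; auto.
Qed.

Lemma limit_no_max l a : limit_ordinal l -> a ∈ l -> exists b, b ∈ l /\ a ∈ b.
Proof.
  intros (Hl & _ & Hs) Ha. apply NNPP. intros Hn. apply Hs. exists a. intros z. split.
  - intros Hz. destruct (ordinal_cases z a) as [H|[H|H]]; eauto using ordinal_mem.
    exfalso. eauto.
  - intros [H| ->]; [|exact Ha]. exact (ordinal_trans l z a Hl H Ha).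
Qed.

(** The transitive collapse of [s] is an ordinal, and it moves no element of
    [s] upwards, so that it stays below [l]. *)
Lemma subset_ordinal_equinumerous s l : ordinal l -> subset s l ->
  exists m, ordinal m /\ le m l /\ equinumerous s m.
Proof.
  intros Hl Hs.
  destruct (wf_recursion s (fun y x => y ∈ x)
    (fun x u => img (sep s (fun y => y ∈ x)) (ap u))) as (f & Hf & E);
    [definable|definable|apply wf_mem|].
  assert (in_f : forall x z, x ∈ s -> z ∈ ap f x <-> exists y, y ∈ s /\ y ∈ x /\ z = ap f y).
  { intros x z Hx. rewrite E by exact Hx. rewrite in_img by definable.
    split; intros (y & H).
    - destruct H as [Hy ->]. exists y. rewrite ap_lam; [|definable|exact Hy].
      apply in_sep in Hy; [tauto|definable].
    - destruct H as (Hy & Hyx & ->).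
      assert (Hy' : y ∈ sep s (fun y => y ∈ x)) by (apply in_sep; [definable|auto]).
      exists y. rewrite ap_lam; [auto|definable|exact Hy']. }
  assert (Hle : forall x, x ∈ s -> le (ap f x) x).
  { apply (wf_induction s (fun y x => y ∈ x) (fun x => le (ap f x) x));
      [definable|apply wf_mem|].
    intros x Hx IH. pose proof (ordinal_mem l x Hl (Hs x Hx)) as Hxo.
    apply transitive_subset_le; [exact Hxo| |].
    - intros z Hz t Ht. apply in_f in Hz; [|exact Hx]. destruct Hz as (y & Hy & Hyx & ->).
      apply in_f in Ht; [|exact Hy]. destruct Ht as (v & Hv & Hvy & ->).
      apply in_f; [exact Hx|]. exists v. eauto using ordinal_trans.
    - intros z Hz. apply in_f in Hz; [|exact Hx]. destruct Hz as (y & Hy & Hyx & ->).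
      apply (le_mem_trans _ y); auto. }
  set (m := img s (ap f)).
  assert (in_m : forall z, z ∈ m <-> exists x, x ∈ s /\ z = ap f x)
    by (intros z; apply in_img; definable).
  assert (Hmt : transitive m).
  { intros z Hz t Ht. apply in_m in Hz. destruct Hz as (x & Hx & ->).
    apply in_f in Ht; [|exact Hx]. destruct Ht as (y & Hy & _ & ->). apply in_m. eauto. }
  assert (Hml : subset m l).
  { intros z Hz. apply in_m in Hz. destruct Hz as (x & Hx & ->).
    apply (le_mem_trans _ x); auto. }
  exists m. split; [|split].
  - exact (transitive_subset_ordinal m l Hl Hmt Hml).
  - exact (transitive_subset_le m l Hl Hmt Hml).
  - exists f. split; [|split].
    + apply function_from_to_iff. split; [exact Hf|]. intros x Hx. apply in_m. eauto.
    + intros x x' y Hxy Hxy'. apply (app_iff f s) in Hxy, Hxy'; try exact Hf.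
      destruct Hxy as [Hx ->], Hxy' as [Hx' Exx'].
      destruct (ordinal_cases x x') as [H|[H|H]];
        [apply (ordinal_mem l); auto|apply (ordinal_mem l); auto| |exact H|];
        exfalso; apply (mem_irrefl (ap f x)).
      * rewrite Exx' at 2. apply in_f; eauto.
      * rewrite Exx' at 1. apply in_f; eauto.
    + intros y Hy. apply in_m in Hy. destruct Hy as (x & Hx & ->).
      exists x. apply (app_ap f s); assumption.
Qed.

Lemma equinumerous_trans a b c : equinumerous a b -> equinumerous b c -> equinumerous a c.
Proof.
  intros (f & Hf & If & Sf) (g & Hg & Ig & Sg).
  pose proof (proj1 Hf) as Hf1. pose proof (proj1 Hg) as Hg1.
  assert (Hh : forall x z, app (lam a (fun x => ap g (ap f x))) x z <->
      exists y, app f x y /\ app g y z).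
  { intros x z. rewrite app_lam by definable. split.
    - intros [Hx ->]. exists (ap f x). split; [apply (app_ap f a); assumption|].
      apply (app_ap g b); [exact Hg1|]. apply (ap_in f a b); assumption.
    - intros (y & Hy & Hz). apply (app_iff f a) in Hy; [|exact Hf1]. destruct Hy as [Hx ->].
      apply (app_iff g b) in Hz; [|exact Hg1]. tauto. }
  exists (lam a (fun x => ap g (ap f x))). split; [|split].
  - apply function_from_to_lam; [definable|].
    intros x Hx. apply (ap_in g b c); [exact Hg|]. apply (ap_in f a b); assumption.
  - intros x x' z Hx Hx'. apply Hh in Hx, Hx'.
    destruct Hx as (y & Hy & Hz), Hx' as (y' & Hy' & Hz').
    rewrite (Ig _ _ _ Hz Hz') in Hy. eauto.
  - intros z Hz. destruct (Sg z Hz) as (y & Hy).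
    assert (Hyb : y ∈ b) by (apply (proj2 Hg1); exists z; exact Hy).
    destruct (Sf y Hyb) as (x & Hx). exists x. apply Hh. eauto.
Qed.

Lemma equinumerous_sym a b : equinumerous a b -> equinumerous b a.
Proof.
  intros (f & Hf & If & Sf). pose proof (proj1 Hf) as Hf1.
  set (h := fun y => the (fun x => app f x y)).
  assert (Hh : dterm1 h) by (unfold h; definable).
  assert (Hhf : forall x y, app f x y -> h y = x).
  { intros x y Hxy. apply the_eq; [exact Hxy|]. intros z Hz. exact (If _ _ _ Hz Hxy). }
  exists (lam b h). split; [|split].
  - apply function_from_to_lam; [exact Hh|].
    intros y Hy. destruct (Sf y Hy) as (x & Hx). rewrite (Hhf x y Hx).
    apply (proj2 Hf1). exists y. exact Hx.
  - intros y y' x Hy Hy'. apply app_lam in Hy, Hy'; try exact Hh.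
    destruct Hy as [Hy ->], Hy' as [Hy' E].
    destruct (Sf y Hy) as (x & Hx). destruct (Sf y' Hy') as (x' & Hx').
    rewrite (Hhf _ _ Hx), (Hhf _ _ Hx') in E. subst x'.
    exact (proj2 (proj1 Hf1) _ _ _ Hx Hx').
  - intros x Hx. exists (ap f x). apply app_lam; [exact Hh|]. split.
    + apply (ap_in f a b); assumption.
    + symmetry. apply Hhf, (app_ap f a); assumption.
Qed.

(** A surjection of an ordinal is injective on the set of least preimages.  The
    closure properties of ultrafilters bound the cardinality of a set of sets;
    this makes them applicable to indexed families. *)
Lemma img_ordinal_smaller n m F : ordinal n -> m ∈ n -> dterm1 F -> smaller (img m F) n.
Proof.
  intros Hn Hm HF. pose proof (ordinal_mem n m Hn Hm) as Hmo.
  set (s := sep m (fun i => forall j, j ∈ i -> F j <> F i)).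
  assert (in_s : forall i, i ∈ s <-> i ∈ m /\ forall j, j ∈ i -> F j <> F i)
    by (intros i; unfold s; rewrite in_sep by definable; tauto).
  assert (Hsm : subset s m) by (intros i Hi; apply in_s in Hi; tauto).
  destruct (subset_ordinal_equinumerous s m Hmo Hsm) as (k & Hk & Hkm & Hsk).
  exists k. split; [exact (le_mem_trans k m n Hn Hkm Hm)|].
  apply (equinumerous_trans _ s); [|exact Hsk]. apply equinumerous_sym.
  exists (lam s F). split; [|split].
  - apply function_from_to_lam; [exact HF|]. intros i Hi. apply in_img_intro; auto.
  - intros i j y Hi Hj. apply app_lam in Hi, Hj; try exact HF.
    destruct Hi as [Hi ->], Hj as [Hj E].
    destruct (ordinal_cases i j) as [H|[H|H]];
      [apply (ordinal_mem m); auto|apply (ordinal_mem m); auto| |exact H|].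
    + apply in_s in Hj. exfalso. exact (proj2 Hj i H E).
    + apply in_s in Hi. exfalso. exact (proj2 Hi j H (eq_sym E)).
  - intros y Hy. apply in_img in Hy; [|exact HF]. destruct Hy as (i & Hi & ->).
    destruct (least_element (sep m (fun j => F j = F i))) as (j & Hj & Hmin).
    + exists i. apply in_sep; [definable|auto].
    + intros x Hx. apply in_sep in Hx; [|definable]. apply (ordinal_mem m); tauto.
    + apply in_sep in Hj; [|definable]. destruct Hj as [Hj Ej].
      exists j. apply app_lam; [exact HF|]. split; [|auto]. apply in_s. split; [exact Hj|].
      intros x Hx Ex. apply (le_not_mem j x); [apply (ordinal_mem j); [apply (ordinal_mem m)|]; auto| |exact Hx].
      apply Hmin, in_sep; [definable|]. split; [|congruence]. exact (ordinal_trans m x j Hmo Hx Hj).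
Qed.

(** Otherwise the power set of [a] would be injected into [a], and [r] is
    Cantor's diagonal set for this injection. *)
Lemma mem_two_pow a c : ordinal a -> is_two_pow c a -> a ∈ c.
Proof.
  intros Ha (p & Hp & [Hc _] & f & Hf & If & _).
  destruct (classic (a ∈ c)) as [H|H]; [exact H|exfalso].
  pose proof (le_subset c a Ha (not_mem_le a c Ha Hc H)) as Hca.
  set (r := sep a (fun i => exists x, app f x i /\ i ∉ x)).
  assert (Hr : r ∈ p) by (apply Hp; intros i Hi; apply in_sep in Hi; [tauto|definable]).
  pose proof (app_ap f p r (proj1 Hf) Hr) as Hfr.
  assert (Hi : ap f r ∈ r <-> ap f r ∈ a /\ exists x, app f x (ap f r) /\ ap f r ∉ x)
    by (unfold r at 2; rewrite in_sep by definable; tauto).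
  assert (Hfa : ap f r ∈ a) by (apply Hca, (ap_in f p c); assumption).
  assert (Hn : ap f r ∉ r).
  { intros H'. pose proof H' as H''. apply Hi in H''. destruct H'' as (_ & x & Hx & Hnx).
    rewrite (If x r _ Hx Hfr) in Hnx. contradiction. }
  apply Hn, Hi. eauto.
Qed.

End Ordinals.

(** * Cofinality *)

Section Cofinality.
Context {V : Type} {M : Membership V} {HV : ZFC V}.
Implicit Types (a d e f g h i j k l m n p s x y z : V).

Definition regular k : Prop := forall m g, m ∈ k -> function_from_to g m k ->
  exists η, η ∈ k /\ forall i, i ∈ m -> ap g i ∈ η.

Lemma le_refl a : le a a.
Proof. right. reflexivity. Qed.

Lemma ordinal_max k a b : ordinal k -> a ∈ k -> b ∈ k -> exists c, c ∈ k /\ le a c /\ le b c.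
Proof.
  intros Hk Ha Hb. destruct (ordinal_cases a b) as [H|[H|H]];
    [exact (ordinal_mem k a Hk Ha)|exact (ordinal_mem k b Hk Hb)| | |].
  - exists b. split; [exact Hb|]. split; [left; exact H|apply le_refl].
  - exists b. split; [exact Hb|]. split; [right; exact H|apply le_refl].
  - exists a. split; [exact Ha|]. split; [apply le_refl|left; exact H].
Qed.

Lemma below_cofinality_bounded k l m g : ordinal l -> is_cof k l -> m ∈ k ->
  function_from_to g m l -> exists β, β ∈ l /\ forall i, i ∈ m -> ap g i ∈ β.
Proof.
  intros Hl (_ & _ & Hmin) Hm Hg. apply NNPP. intros Hn. apply (Hmin m Hm). exists g.
  split; [exact Hg|]. intros x Hx. apply NNPP. intros Hn'. apply Hn. exists x.
  split; [exact Hx|]. intros i Hi. apply NNPP. intros Hix. apply Hn'. exists i, (ap g i).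
  split; [apply (app_ap g m); [apply Hg|exact Hi]|].
  apply not_mem_le; [|exact (ordinal_mem l x Hl Hx)|exact Hix].
  apply (ordinal_mem l); [exact Hl|]. apply (ap_in g m l); assumption.
Qed.

Lemma cofinal_sequence k l : limit_ordinal l -> is_cof k l -> exists e,
  function_from_to e k l /\
  (forall x, x ∈ l -> exists ξ, ξ ∈ k /\ x ∈ ap e ξ) /\
  (forall ξ, ξ ∈ k -> exists β, β ∈ l /\ forall η, le η ξ -> ap e η ∈ β).
Proof.
  intros Hl Hk. pose proof (proj1 Hl) as Hlo. pose proof (proj1 Hk) as Hko.
  pose proof Hk as (_ & (e & He & Hcof) & _). exists e. split; [exact He|]. split.
  - intros x Hx. destruct (limit_no_max l x Hl Hx) as (x' & Hx' & Hxx').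
    destruct (Hcof x' Hx') as (ξ & y & Hξ & Hy). apply (app_iff e k) in Hξ; [|apply He].
    destruct Hξ as [Hξ ->]. exists ξ. split; [exact Hξ|].
    apply (le_subset x' (ap e ξ)); [|exact Hy|exact Hxx'].
    apply (ordinal_mem l); [exact Hlo|]. apply (ap_in e k l); assumption.
  - intros ξ Hξ.
    destruct (below_cofinality_bounded k l ξ (lam ξ (ap e)) Hlo Hk Hξ) as (β & Hβ & Hb).
    { apply function_from_to_lam; [definable|]. intros η Hη. apply (ap_in e k l); [exact He|].
      exact (ordinal_trans k η ξ Hko Hη Hξ). }
    assert (Heξ : ap e ξ ∈ l) by (apply (ap_in e k l); assumption).
    destruct (limit_no_max l (ap e ξ) Hl Heξ) as (β' & Hβ' & Hb').
    destruct (ordinal_max l β β' Hlo Hβ Hβ') as (γ & Hγ & H1 & H2).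
    pose proof (ordinal_mem l γ Hlo Hγ) as Hγo.
    exists γ. split; [exact Hγ|]. intros η [Hη| ->].
    + apply (le_subset β γ Hγo H1). specialize (Hb η Hη).
      rewrite ap_lam in Hb; [exact Hb|definable|exact Hη].
    + exact (le_subset β' γ Hγo H2 _ Hb').
Qed.

(** A short cofinal map [g] into [k] would yield a short cofinal map into [l]:
    send [i] to a bound for the values of [e] up to [g(i)]. *)
Lemma cofinality_regular k l : limit_ordinal l -> is_cof k l -> regular k.
Proof.
  intros Hl Hk m g Hm Hg. pose proof (proj1 Hl) as Hlo. pose proof (proj1 Hk) as Hko.
  destruct (cofinal_sequence k l Hl Hk) as (e & He & Hcof & Hbd).
  destruct (choice_function m l (fun i β => forall η, le η (ap g i) -> ap e η ∈ β))
    as (h & Hh & Hhe); [definable| |].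
  { intros i Hi. apply Hbd, (ap_in g m k); assumption. }
  destruct (below_cofinality_bounded k l m h Hlo Hk Hm Hh) as (β & Hβ & Hhβ).
  destruct (Hcof β Hβ) as (ξ & Hξ & Hβξ).
  exists ξ. split; [exact Hξ|]. intros i Hi.
  assert (Hgi : ap g i ∈ k) by (apply (ap_in g m k); assumption).
  apply NNPP. intros Hn.
  assert (Hle : le ξ (ap g i)) by (apply not_mem_le; eauto using ordinal_mem).
  assert (Heo : ordinal β) by (apply (ordinal_mem l); assumption).
  apply (mem_irrefl β). apply (ordinal_trans β β (ap e ξ) Heo Hβξ).
  exact (ordinal_trans β _ (ap h i) Heo (Hhe i Hi ξ Hle) (Hhβ i Hi)).
Qed.

Lemma regular_is_cardinal k : ordinal k -> regular k -> cardinal k.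
Proof.
  intros Hk Hr. split; [exact Hk|]. intros m Hm (f & Hf & _ & Sf).
  destruct (Hr m f Hm Hf) as (η & Hη & Hb). destruct (Sf η Hη) as (i & Hi).
  apply (app_iff f m) in Hi; [|apply Hf]. destruct Hi as [Hi E].
  apply (mem_irrefl η). rewrite E at 1. apply Hb, Hi.
Qed.

(** The form in which regularity is used: bounds that exist for each index can be
    chosen independently of the index. *)
Lemma regular_uniform_bound k m (Q : V -> V -> Prop) : ordinal k -> regular k -> m ∈ k ->
  dfn2 Q -> (forall i η η', i ∈ m -> η' ∈ k -> η ∈ η' -> Q i η -> Q i η') ->
  (forall i, i ∈ m -> exists η, η ∈ k /\ Q i η) ->
  exists η, η ∈ k /\ forall i, i ∈ m -> Q i η.
Proof.
  intros Hk Hr Hm HQ Hup Hex.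
  destruct (choice_function m k Q HQ Hex) as (g & Hg & HgQ).
  destruct (Hr m g Hm Hg) as (η & Hη & Hb). exists η. split; [exact Hη|].
  intros i Hi. apply (Hup i (ap g i)); auto.
Qed.

(** The segment with index [ξ] consists of the elements below some [e(η)] with
    [η ≤ ξ]; admitting all these [η] makes the sequence increasing even if the
    cofinal map [e] is not. *)
Lemma cofinal_initial_segments k l A : limit_ordinal l -> is_cof k l -> subset A l ->
  exists B : V -> V, dterm1 B /\
    (forall ξ, ξ ∈ k -> exists α, α ∈ l /\ forall z, z ∈ B ξ <-> z ∈ A /\ z ∈ α) /\
    (forall ξ ζ, ζ ∈ k -> le ξ ζ -> subset (B ξ) (B ζ)) /\
    (forall z, z ∈ A <-> exists ξ, ξ ∈ k /\ z ∈ B ξ).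
Proof.
  intros Hl Hk HA. pose proof (proj1 Hl) as Hlo. pose proof (proj1 Hk) as Hko.
  destruct (cofinal_sequence k l Hl Hk) as (e & He & Hcof & Hbd).
  exists (fun ξ => sep A (fun z => exists η, le η ξ /\ z ∈ ap e η)).
  split; [definable|]. split; [|split].
  - intros ξ Hξ.
    destruct (least_element (sep l (fun β => forall η, le η ξ -> le (ap e η) β)))
      as (α & Hα & Hmin).
    { destruct (Hbd ξ Hξ) as (β & Hβ & Hb). exists β. apply in_sep; [definable|].
      split; [exact Hβ|]. intros η Hη. left. auto. }
    { intros x Hx. apply in_sep in Hx; [|definable]. apply (ordinal_mem l); tauto. }
    apply in_sep in Hα; [|definable]. destruct Hα as [Hα Hb].
    pose proof (ordinal_mem l α Hlo Hα) as Hαo.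
    exists α. split; [exact Hα|]. intros z. rewrite in_sep by definable.
    split; intros [Hz H]; (split; [exact Hz|]).
    + destruct H as (η & Hη & Hz'). exact (le_subset _ α Hαo (Hb η Hη) z Hz').
    + apply NNPP. intros Hn. pose proof (ordinal_mem α z Hαo H) as Hzo.
      apply (le_not_mem α z Hzo); [|exact H]. apply Hmin. apply in_sep; [definable|].
      split; [exact (HA z Hz)|]. intros η Hη. apply not_mem_le; [exact Hzo| |].
      * apply (ordinal_mem l); [exact Hlo|]. apply (ap_in e k l); [exact He|].
        exact (le_mem_trans η ξ k Hko Hη Hξ).
      * intros Hz'. eauto.
  - intros ξ ζ Hζ Hle z Hz. apply in_sep in Hz; [|definable]. apply in_sep; [definable|].
    destruct Hz as [Hz (η & Hη & Hz')]. split; [exact Hz|]. exists η. split; [|exact Hz'].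
    apply (le_trans η ξ ζ); [exact (ordinal_mem k ζ Hko Hζ)|exact Hη|exact Hle].
  - intros z. split.
    + intros Hz. destruct (Hcof z (HA z Hz)) as (ξ & Hξ & Hzξ). exists ξ.
      split; [exact Hξ|]. apply in_sep; [definable|]. split; [exact Hz|].
      exists ξ. auto using le_refl.
    + intros (ξ & _ & Hz). apply in_sep in Hz; [tauto|definable].
Qed.

(** * Deciding families *)

(** Together with [decides], this is all that the construction needs of a
    complete ultrafilter [D] on [k], and weak compactness can provide it too. *)
Definition jointly_unbounded d k D : Prop :=
  forall Y, function_from_to Y d D -> forall ξ, ξ ∈ k ->
    exists ζ, ζ ∈ k /\ le ξ ζ /\ forall i, i ∈ d -> ζ ∈ ap Y i.

(** The sets to be decided form a family indexed by [k × d]: few enough for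
    weak compactness, whereas an ultrafilter decides all sets. *)
Definition decides d k D (b : V -> V -> V -> Prop) : Prop :=
  forall ξ i, ξ ∈ k -> i ∈ d ->
    sep k (fun ζ => b ξ i ζ) ∈ D \/ sep k (fun ζ => ~ b ξ i ζ) ∈ D.

Lemma complete_ultrafilter_jointly_unbounded d k n D : ordinal n -> d ∈ n ->
  ultrafilter k D -> closed_below n k D -> (forall x, cobounded_in x k -> x ∈ D) ->
  jointly_unbounded d k D.
Proof.
  intros Hn Hd [HD _] Hcl Hcob Y HY ξ Hξ.
  assert (HI : sep k (fun ζ => forall x, x ∈ img d (ap Y) -> ζ ∈ x) ∈ D).
  { apply (Hcl (img d (ap Y))).
    - intros x Hx. apply in_img in Hx; [|definable]. destruct Hx as (i & Hi & ->).
      apply (ap_in Y d D); assumption.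
    - apply img_ordinal_smaller; [exact Hn|exact Hd|definable].
    - intros t. rewrite in_sep by definable. tauto. }
  assert (HT : sep k (fun ζ => le ξ ζ) ∈ D).
  { apply Hcob. split.
    - intros ζ Hζ. apply in_sep in Hζ; [tauto|definable].
    - exists ξ. split; [exact Hξ|]. intros ζ Hζ Hle. apply in_sep; [definable|auto]. }
  destruct HD as (_ & _ & Hne & _ & Hint).
  destruct (Hne (sep k (fun ζ => le ξ ζ /\ forall x, x ∈ img d (ap Y) -> ζ ∈ x))) as (ζ & Hζ).
  { apply (Hint _ _ _ HT HI). intros t. rewrite !in_sep by definable. tauto. }
  apply in_sep in Hζ; [|definable]. destruct Hζ as (Hζ & Hle & Hall).
  exists ζ. split; [exact Hζ|]. split; [exact Hle|].
  intros i Hi. apply Hall, in_img_intro; [definable|exact Hi].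
Qed.

Lemma ultrafilter_decides d k D b : dfn3 b -> ultrafilter k D -> decides d k D b.
Proof.
  intros Hb [_ HD] ξ i _ _. apply (HD (sep k (fun ζ => b ξ i ζ))).
  - intros ζ Hζ. apply in_sep in Hζ; [tauto|definable].
  - intros ζ. rewrite !in_sep by definable. tauto.
Qed.

(** * Weakly compact cardinals *)

Section WeaklyCompact.
Variables (d k : V) (b : V -> V -> V -> Prop).
Hypotheses (Hb : dfn3 b) (Hk : ordinal k) (Hr : regular k) (Hd : d ∈ k).

(** View [ζ] as the sequence of truth values [c(ξ,i,ζ)] along the lexicographic
    order of [k × d].  This is agreement of two sequences below [(ξ,i)]. *)
Definition agree (c : V -> V -> V -> Prop) ξ i ζ ζ' : Prop :=
  forall ξ' i', ξ' ∈ k -> i' ∈ d -> ξ' ∈ ξ \/ (ξ' = ξ /\ i' ∈ i) ->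
    (c ξ' i' ζ <-> c ξ' i' ζ').

(** Each coordinate of a lexicographically monotone sequence of length [k] is
    eventually constant: once all previous coordinates are constant, which
    happens below [k] by regularity, the coordinate can change only once. *)
Lemma monotone_stabilizes (c : V -> V -> V -> Prop) H : dfn3 c -> subset H k ->
  (forall ξ i ζ ζ', ξ ∈ k -> i ∈ d -> ζ ∈ H -> ζ' ∈ H -> ζ ∈ ζ' ->
     agree c ξ i ζ ζ' -> c ξ i ζ -> c ξ i ζ') ->
  forall ξ, ξ ∈ k -> forall i, i ∈ d -> exists η, η ∈ k /\
    ((forall ζ, ζ ∈ H -> le η ζ -> c ξ i ζ) \/ (forall ζ, ζ ∈ H -> le η ζ -> ~ c ξ i ζ)).
Proof.
  intros Hc HH Hmono.
  set (St := fun ξ i η =>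
    (forall ζ, ζ ∈ H -> le η ζ -> c ξ i ζ) \/ (forall ζ, ζ ∈ H -> le η ζ -> ~ c ξ i ζ)).
  assert (HSt : dfn3 St) by (unfold St; definable).
  assert (Hup : forall ξ i η η', le η η' -> St ξ i η -> St ξ i η').
  { intros ξ i η η' Hle [Hs|Hs]; [left|right]; intros ζ Hζ Hle'; apply Hs; auto;
      apply (le_trans η η' ζ); auto; apply (ordinal_mem k); auto. }
  apply (wf_induction k (fun y x => y ∈ x)
    (fun ξ => forall i, i ∈ d -> exists η, η ∈ k /\ St ξ i η)); [definable|apply wf_mem|].
  intros ξ Hξ IHξ.
  apply (wf_induction d (fun y x => y ∈ x) (fun i => exists η, η ∈ k /\ St ξ i η));
    [definable|apply wf_mem|].
  intros i Hi IHi.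
  destruct (regular_uniform_bound k ξ (fun ξ' η => forall i', i' ∈ d -> St ξ' i' η))
    as (η1 & Hη1 & H1); [exact Hk|exact Hr|exact Hξ|definable| | |].
  { intros ξ' η η' _ _ Hηη' Hs i' Hi'. apply (Hup ξ' i' η); [left; exact Hηη'|auto]. }
  { intros ξ' Hξ'.
    apply (regular_uniform_bound k d (St ξ')); [exact Hk|exact Hr|exact Hd|definable| |].
    - intros i' η η' _ _ Hηη'. apply Hup. left. exact Hηη'.
    - apply IHξ; [exact (ordinal_trans k ξ' ξ Hk Hξ' Hξ)|exact Hξ']. }
  destruct (regular_uniform_bound k i (St ξ)) as (η2 & Hη2 & H2);
    [exact Hk|exact Hr|exact (ordinal_trans k i d Hk Hi Hd)|definable| | |].
  { intros i' η η' _ _ Hηη'. apply Hup. left. exact Hηη'. }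
  { intros i' Hi'. apply IHi; [|exact Hi'].
    exact (ordinal_trans d i' i (ordinal_mem k d Hk Hd) Hi' Hi). }
  destruct (ordinal_max k η1 η2 Hk Hη1 Hη2) as (η & Hη & Hle1 & Hle2).
  assert (Hag : forall ζ ζ', ζ ∈ H -> ζ' ∈ H -> le η ζ -> le η ζ' -> agree c ξ i ζ ζ').
  { intros ζ ζ' Hζ Hζ' Hle Hle' ξ' i' Hξ' Hi' Hlt.
    assert (Hs : St ξ' i' η).
    { destruct Hlt as [Hlt|[-> Hlt]]; [apply (Hup _ _ η1)|apply (Hup _ _ η2)]; auto. }
    destruct Hs as [Hs|Hs]; pose proof (Hs ζ Hζ Hle); pose proof (Hs ζ' Hζ' Hle'); tauto. }
  destruct (classic (exists ζ, ζ ∈ H /\ le η ζ /\ c ξ i ζ)) as [(ζ0 & Hζ0 & Hle0 & Hc0)|Hn].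
  - exists ζ0. split; [auto|]. left. intros ζ Hζ [Hlt| <-]; [|exact Hc0].
    apply (Hmono ξ i ζ0 ζ); auto. apply Hag; auto.
    apply (le_trans η ζ0 ζ); [apply (ordinal_mem k); auto|exact Hle0|left; exact Hlt].
  - exists η. split; [exact Hη|]. right. intros ζ Hζ Hle Hcz. eauto.
Qed.

(** Colour a pair [ζ ∈ ζ'] by the lexicographic order of the two sequences of
    truth values.  A homogeneous set is lexicographically monotone, so its
    tails decide all the sets in question. *)
Lemma weakly_compact_decides : weakly_compact k ->
  exists D, jointly_unbounded d k D /\ decides d k D b.
Proof.
  intros [[[_ Hcard] _] Hwc].
  set (up := fun ζ ζ' => exists ξ i, ξ ∈ k /\ i ∈ d /\ agree b ξ i ζ ζ' /\ ~ b ξ i ζ /\ b ξ i ζ').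
  assert (Hupd : dfn2 up) by (unfold up, agree; definable).
  set (c := sep (power k) (fun p => exists ζ ζ', ζ ∈ ζ' /\ is_unordered_pair p ζ ζ' /\ up ζ ζ')).
  assert (in_c : forall ζ ζ', ζ ∈ k -> ζ' ∈ k -> ζ ∈ ζ' -> upair ζ ζ' ∈ c <-> up ζ ζ').
  { intros ζ ζ' Hζ Hζ' Hlt. unfold c. rewrite in_sep by definable. split.
    - intros (_ & x & y & Hxy & Hp & Hup).
      assert (x = ζ /\ y = ζ') as [<- <-]; [|exact Hup].
      assert (Hx : x = ζ \/ x = ζ') by (apply in_upair, Hp; auto).
      assert (Hy : y = ζ \/ y = ζ') by (apply in_upair, Hp; auto).
      destruct Hx as [-> | ->], Hy as [-> | ->]; auto; exfalso.
      + exact (mem_irrefl _ Hxy).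
      + pose proof (ordinal_mem k ζ Hk Hζ) as Ho.
        exact (mem_irrefl ζ (ordinal_trans ζ ζ ζ' Ho Hlt Hxy)).
      + exact (mem_irrefl _ Hxy).
    - intros Hup. split.
      + apply in_power. intros z Hz. apply in_upair in Hz. destruct Hz as [-> | ->]; assumption.
      + exists ζ, ζ'. auto using upair_spec. }
  destruct (Hwc c) as (H & HH & HHk & Hhom).
  assert (Hunb : forall η, η ∈ k -> exists ζ, ζ ∈ H /\ le η ζ).
  { intros η Hη. apply NNPP. intros Hn. pose proof (ordinal_mem k η Hk Hη) as Hηo.
    destruct (subset_ordinal_equinumerous H η Hηo) as (m & _ & Hmη & HHm).
    - intros ζ Hζ. apply NNPP. intros Hn'. apply Hn. exists ζ. split; [exact Hζ|].
      apply not_mem_le; auto. apply (ordinal_mem k); auto.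
    - apply (Hcard m (le_mem_trans m η k Hk Hmη Hη)).
      apply (equinumerous_trans m H k); [apply equinumerous_sym, HHm|exact HHk]. }
  assert (Hne : forall ζ ζ', ζ ∈ ζ' -> ζ <> ζ') by (intros ζ ζ' Hlt ->; exact (mem_irrefl _ Hlt)).
  assert (Hst : forall ξ, ξ ∈ k -> forall i, i ∈ d -> exists η, η ∈ k /\
    ((forall ζ, ζ ∈ H -> le η ζ -> b ξ i ζ) \/ (forall ζ, ζ ∈ H -> le η ζ -> ~ b ξ i ζ))).
  { destruct Hhom as [Hhom|Hhom].
    - apply monotone_stabilizes; [exact Hb|exact HH|].
      intros ξ i ζ ζ' Hξ Hi Hζ Hζ' Hlt Hag Hbz.
      assert (Hup : up ζ ζ')
        by (apply in_c; auto; apply (Hhom ζ ζ'); auto using upair_spec).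
      destruct Hup as (ξ1 & i1 & Hξ1 & Hi1 & Hag1 & Hn1 & Hb1).
      (* compare [(ξ,i)] with the first index [(ξ1,i1)] of difference *)
      destruct (ordinal_cases ξ ξ1) as [Hc|[Hc|Hc]]; try (apply (ordinal_mem k); assumption).
      + apply (Hag1 ξ i Hξ Hi); auto.
      + subst ξ1. pose proof (ordinal_mem k d Hk Hd) as Hdo.
        destruct (ordinal_cases i i1) as [Hc|[Hc|Hc]]; try (apply (ordinal_mem d); assumption).
        * apply (Hag1 ξ i Hξ Hi); auto.
        * subst i1. exact Hb1.
        * exfalso. apply Hn1, (Hag ξ i1 Hξ Hi1); auto.
      + exfalso. apply Hn1, (Hag ξ1 i1 Hξ1 Hi1); auto.
    - assert (Hst := monotone_stabilizes (fun ξ i ζ => ~ b ξ i ζ) H ltac:(definable) HH).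
      intros ξ Hξ i Hi. destruct (Hst) with (ξ := ξ) (i := i) as (η & Hη & Hs); [|auto|auto|].
      + clear ξ Hξ i Hi. intros ξ i ζ ζ' Hξ Hi Hζ Hζ' Hlt Hag Hbz Hbz'.
        apply (Hhom ζ ζ' (upair ζ ζ') Hζ Hζ' (Hne _ _ Hlt) (upair_spec ζ ζ')).
        apply in_c; auto. exists ξ, i. split; [exact Hξ|]. split; [exact Hi|].
        split; [|auto]. intros ξ' i' Hξ' Hi' Hlt'. specialize (Hag ξ' i' Hξ' Hi' Hlt'). tauto.
      + exists η. split; [exact Hη|]. destruct Hs as [Hs|Hs]; [right|left]; intros ζ Hζ Hle.
        * auto.
        * apply NNPP. auto. }
  exists (sep (power k) (fun Y => exists η, η ∈ k /\ forall ζ, ζ ∈ H -> le η ζ -> ζ ∈ Y)).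
  split.
  - intros Y HY ξ Hξ.
    destruct (regular_uniform_bound k d (fun i η => forall ζ, ζ ∈ H -> le η ζ -> ζ ∈ ap Y i))
      as (η & Hη & HηY); [exact Hk|exact Hr|exact Hd|definable| | |].
    + intros i η η' _ _ Hlt Hs ζ Hζ Hle. apply Hs; [exact Hζ|].
      apply (le_trans η η' ζ); [apply (ordinal_mem k); auto|left; exact Hlt|exact Hle].
    + intros i Hi. pose proof (ap_in Y d _ i HY Hi) as H1. apply in_sep in H1; [tauto|definable].
    + destruct (ordinal_max k ξ η Hk Hξ Hη) as (θ & Hθ & H1 & H2).
      destruct (Hunb θ Hθ) as (ζ & Hζ & Hle). exists ζ. split; [auto|].
      assert (Hζo : ordinal ζ) by (apply (ordinal_mem k); auto). split.
      * exact (le_trans ξ θ ζ Hζo H1 Hle).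
      * intros i Hi. apply HηY; [exact Hi|exact Hζ|]. exact (le_trans η θ ζ Hζo H2 Hle).
  - intros ξ i Hξ Hi. destruct (Hst ξ Hξ i Hi) as (η & Hη & [Hs|Hs]); [left|right];
      (apply in_sep; [definable|]; split;
        [apply in_power; intros ζ Hζ; apply in_sep in Hζ; [tauto|definable]|]);
      exists η; (split; [exact Hη|]); intros ζ Hζ Hle; apply in_sep; try definable; auto.
Qed.

End WeaklyCompact.

(** * Strongly compact cardinals *)

(** Regularity makes the filter of cobounded sets closed below [k]. *)
Lemma cobounded_filter_extends q k : ordinal k -> regular k -> (exists x, x ∈ k) ->
  strongly_compact q -> le q k ->
  exists D, ultrafilter k D /\ closed_below q k D /\ forall x, cobounded_in x k -> x ∈ D.
Proof.
  intros Hk Hr [x0 Hx0] (_ & _ & Hext) Hqk.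
  set (F := sep (power k) (fun x => cobounded_in x k)).
  assert (in_F : forall x, x ∈ F <-> cobounded_in x k).
  { intros x. unfold F. rewrite in_sep, in_power by definable. split; [tauto|].
    intros H. split; [apply H|exact H]. }
  destruct (Hext k F) as (D & HFD & HD & Hcl).
  - split; [|split; [|split; [|split]]].
    + intros x Hx. apply in_F in Hx. apply Hx.
    + apply in_F. split; [intros z Hz; exact Hz|]. exists x0. auto.
    + intros x Hx. apply in_F in Hx. destruct Hx as [_ (y & Hy & H)].
      exists y. apply H; [exact Hy|apply le_refl].
    + intros x y Hx Hxy Hyk. apply in_F in Hx. apply in_F. split; [exact Hyk|].
      destruct Hx as [_ (z & Hz & H)]. exists z. split; [exact Hz|]. intros t Ht Hle.
      apply Hxy. auto.
    + intros x y z Hx Hy Hz. apply in_F in Hx, Hy. apply in_F.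
      destruct Hx as [Hxk (u & Hu & Hux)], Hy as [_ (v & Hv & Hvy)].
      split; [intros t Ht; apply Hz in Ht; apply Hxk; tauto|].
      destruct (ordinal_max k u v Hk Hu Hv) as (w & Hw & Huw & Hvw).
      exists w. split; [exact Hw|]. intros t Ht Hwt.
      pose proof (ordinal_mem k t Hk Ht) as Hto. apply Hz. split.
      * apply Hux; [exact Ht|]. exact (le_trans u w t Hto Huw Hwt).
      * apply Hvy; [exact Ht|]. exact (le_trans v w t Hto Hvw Hwt).
  - intros g i HgF (m & Hm & (f & Hf & If & _)) Hi.
    assert (Hmk : m ∈ k) by (apply (le_subset q k); assumption).
    destruct (regular_uniform_bound k m (fun j η => forall x, x ∈ g -> app f x j ->
      forall t, t ∈ k -> le η t -> t ∈ x)) as (η & Hη & H);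
      [exact Hk|exact Hr|exact Hmk|definable| | |].
    + intros j η η' _ _ Hlt H x Hx Hxj t Ht Hle. apply (H x Hx Hxj t Ht).
      apply (le_trans η η' t); [exact (ordinal_mem k t Hk Ht)|left; exact Hlt|exact Hle].
    + intros j Hj. destruct (classic (exists x, x ∈ g /\ app f x j)) as [(x & Hx & Hxj)|Hn].
      * pose proof (HgF x Hx) as HxF. apply in_F in HxF. destruct HxF as [_ (η & Hη & H)].
        exists η. split; [exact Hη|]. intros x' _ Hx'j. rewrite (If x' x j Hx'j Hxj). exact H.
      * exists x0. split; [exact Hx0|]. intros x Hx Hxj. exfalso. eauto.
    + apply in_F. split; [intros t Ht; apply Hi in Ht; tauto|].
      exists η. split; [exact Hη|]. intros t Ht Hle. apply Hi. split; [exact Ht|].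
      intros x Hx. apply (H (ap f x)); [apply (ap_in f g m); assumption|exact Hx| |exact Ht|exact Hle].
      apply (app_ap f g); [apply Hf|exact Hx].
  - exists D. split; [exact HD|]. split; [exact Hcl|]. intros x Hx. apply HFD, in_F, Hx.
Qed.

End Cofinality.

(** * The ultrapower *)

Section Ultrapower.
Context {V : Type} {M : Membership V} {HV : ZFC V}.
Implicit Types (a b f g h i j m n p s x y z : V) (P Q : V -> Prop).
Variables (d U : V).
Hypotheses (Hd : measurable d) (HU : normal_ultrafilter d U).

Lemma measurable_ordinal : ordinal d.
Proof. apply Hd. Qed.

(** [P] holds [U]-almost everywhere.  A member of [U] inside [P], instead of
    [P] itself, leaves monotonicity and conjunctions free of definability
    conditions. *)
Definition most P : Prop := exists X, X ∈ U /\ forall i, i ∈ X -> P i.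

Lemma in_ultrafilter_subset X : X ∈ U -> subset X d.
Proof. apply HU. Qed.

Lemma most_mono P Q : most P -> (forall i, i ∈ d -> P i -> Q i) -> most Q.
Proof.
  intros (X & HX & H) HPQ. exists X. split; [exact HX|].
  intros i Hi. apply HPQ; [exact (in_ultrafilter_subset X HX i Hi)|auto].
Qed.

Lemma most_and P Q : most P -> most Q -> most (fun i => P i /\ Q i).
Proof.
  intros (X & HX & H) (Y & HY & H').
  assert (E : forall t, t ∈ sep X (fun t => t ∈ Y) <-> t ∈ X /\ t ∈ Y)
    by (intros t; rewrite in_sep by definable; tauto).
  exists (sep X (fun t => t ∈ Y)). split.
  - apply (proj2 (proj2 (proj2 (proj2 (proj1 (proj1 HU))))) X Y); auto.
  - intros i Hi. apply E in Hi. split; [apply H|apply H']; tauto.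
Qed.

Lemma most_all P : (forall i, i ∈ d -> P i) -> most P.
Proof. intros H. exists d. split; [apply HU|exact H]. Qed.

Lemma most_ex P : most P -> exists i, i ∈ d /\ P i.
Proof.
  intros (X & HX & H). destruct (proj1 (proj2 (proj2 (proj1 (proj1 HU)))) X HX) as [i Hi].
  exists i. split; [exact (in_ultrafilter_subset X HX i Hi)|auto].
Qed.

Lemma most_sep P : dfn1 P -> most P <-> sep d P ∈ U.
Proof.
  intros HP. split.
  - intros (X & HX & H). apply (proj1 (proj2 (proj2 (proj2 (proj1 (proj1 HU))))) X); [exact HX| |].
    + intros i Hi. apply in_sep; [exact HP|].
      split; [exact (in_ultrafilter_subset X HX i Hi)|auto].
    + intros i Hi. apply in_sep in Hi; tauto.
  - intros H. exists (sep d P). split; [exact H|].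
    intros i Hi. apply in_sep in Hi; tauto.
Qed.

Lemma most_not P : dfn1 P -> ~ most P -> most (fun i => ~ P i).
Proof.
  intros HP Hn.
  destruct (proj2 (proj1 HU) (sep d P) (sep d (fun i => ~ P i))) as [H|H].
  - intros i Hi. apply in_sep in Hi; tauto.
  - intros i. rewrite !in_sep by definable. tauto.
  - exfalso. apply Hn, most_sep; assumption.
  - apply most_sep; [definable|exact H].
Qed.

Lemma not_most_both P : most P -> most (fun i => ~ P i) -> False.
Proof.
  intros H H'. destruct (most_ex _ (most_and _ _ H H')) as (i & _ & Hi). tauto.
Qed.

Lemma most_small_all m (P : V -> V -> Prop) : dfn2 P -> m ∈ d ->
  (forall j, j ∈ m -> most (P j)) -> most (fun i => forall j, j ∈ m -> P j i).
Proof.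
  intros HP Hm H.
  set (g := img m (fun j => sep d (P j))).
  exists (sep d (fun i => forall x, x ∈ g -> i ∈ x)). split.
  - apply (proj1 (proj2 (proj2 HU)) g).
    + intros x Hx. apply in_img in Hx; [|definable]. destruct Hx as (j & Hj & ->).
      apply most_sep; [definable|auto].
    + apply img_ordinal_smaller; [apply measurable_ordinal|exact Hm|definable].
    + intros t. rewrite in_sep by definable. tauto.
  - intros i Hi j Hj. apply in_sep in Hi; [|definable]. destruct Hi as [_ Hi].
    specialize (Hi (sep d (P j))). rewrite in_sep in Hi by definable. apply Hi.
    apply (in_img_intro m (fun j => sep d (P j))); [definable|exact Hj].
Qed.

Lemma most_above j : j ∈ d -> most (fun i => j ∈ i).
Proof.
  intros Hj. pose proof measurable_ordinal as Ho.
  assert (Hne : forall k, k ∈ d -> most (fun i => i <> k)).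
  { intros k Hk. apply most_not; [definable|]. intros H. apply most_sep in H; [|definable].
    apply (proj1 (proj2 HU) k (sep d (fun i => i = k)) Hk); [|exact H].
    intros z. rewrite in_sep by definable. split; [tauto|intros ->; auto]. }
  assert (H := most_small_all j (fun k i => i <> k) ltac:(definable) Hj).
  assert (H' := most_and _ _ (Hne j Hj) (H (fun k Hk => Hne k (ordinal_trans d k j Ho Hk Hj)))).
  apply (most_mono _ _ H'). intros i Hi [Hij Hlt].
  destruct (ordinal_cases i j) as [Hc|[Hc|Hc]]; try (apply (ordinal_mem d); assumption).
  - exfalso. exact (Hlt i Hc eq_refl).
  - contradiction.
  - exact Hc.
Qed.

(** Normality of [U]: the range of the intersection may grow with [i]. *)
Lemma most_diagonal (P : V -> V -> Prop) : dfn2 P ->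
  (forall j, j ∈ d -> most (P j)) -> most (fun i => forall j, j ∈ i -> P j i).
Proof.
  intros HP H. pose proof measurable_ordinal as Ho.
  set (h := lam d (fun j => sep d (P j))).
  exists (sep d (fun i => forall j x, j ∈ i -> app h j x -> i ∈ x)). split.
  - apply (proj2 (proj2 (proj2 HU)) h).
    + apply function_from_to_lam; [definable|]. intros j Hj. apply most_sep; [definable|auto].
    + intros i. rewrite in_sep by definable. tauto.
  - intros i Hi j Hj. apply in_sep in Hi; [|definable]. destruct Hi as [Hi H'].
    specialize (H' j (sep d (P j)) Hj). rewrite in_sep in H' by definable. apply H'.
    apply app_lam; [definable|]. split; [exact (ordinal_trans d j i Ho Hj Hi)|reflexivity].
Qed.

Definition fn f : Prop := function_on f d.

Lemma fn_lam (F : V -> V) : dterm1 F -> fn (lam d F).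
Proof. apply function_on_lam. Qed.

Lemma ult_mem_most f g : fn f -> fn g ->
  ult_mem d U f g <-> most (fun i => ap f i ∈ ap g i).
Proof.
  intros Hf Hg. rewrite most_sep by definable. unfold ult_mem.
  assert (E : forall i, i ∈ sep d (fun i => ap f i ∈ ap g i) <->
    i ∈ d /\ exists y z, app f i y /\ app g i z /\ y ∈ z).
  { intros i. rewrite in_sep by definable. split; intros [Hi H]; (split; [exact Hi|]).
    - exists (ap f i), (ap g i). split; [apply (app_ap f d)|split; [apply (app_ap g d)|]]; assumption.
    - destruct H as (y & z & Hy & Hz & Hyz).
      apply (app_iff f d) in Hy; [|exact Hf]. apply (app_iff g d) in Hz; [|exact Hg].
      destruct Hy as [_ ->], Hz as [_ ->]. exact Hyz. }
  split.
  - intros (x & Hx & H). replace (sep d (fun i => ap f i ∈ ap g i)) with x; [exact Hx|].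
    apply set_ext. intros i. rewrite H, E. tauto.
  - intros H. exists (sep d (fun i => ap f i ∈ ap g i)). split; [exact H|exact E].
Qed.

Lemma ult_eq_most f g : fn f -> fn g ->
  ult_eq d U f g <-> most (fun i => ap f i = ap g i).
Proof.
  intros Hf Hg. rewrite most_sep by definable. unfold ult_eq.
  assert (E : forall i, i ∈ sep d (fun i => ap f i = ap g i) <->
    i ∈ d /\ exists y, app f i y /\ app g i y).
  { intros i. rewrite in_sep by definable. split; intros [Hi H]; (split; [exact Hi|]).
    - exists (ap f i). split; [exact (app_ap f d i Hf Hi)|].
      rewrite H. exact (app_ap g d i Hg Hi).
    - destruct H as (y & Hy & Hz).
      apply (app_iff f d) in Hy; [|exact Hf]. apply (app_iff g d) in Hz; [|exact Hg].
      destruct Hy as [_ ->], Hz as [_ ->]. reflexivity. }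
  split.
  - intros (x & Hx & H). replace (sep d (fun i => ap f i = ap g i)) with x; [exact Hx|].
    apply set_ext. intros i. rewrite H, E. tauto.
  - intros H. exists (sep d (fun i => ap f i = ap g i)). split; [exact H|exact E].
Qed.

Lemma ult_eq_refl f : fn f -> ult_eq d U f f.
Proof. intros Hf. apply ult_eq_most; auto. apply most_all. auto. Qed.

Lemma ult_eq_sym f g : fn f -> fn g -> ult_eq d U f g -> ult_eq d U g f.
Proof.
  intros Hf Hg H. apply ult_eq_most in H; auto. apply ult_eq_most; auto.
  apply (most_mono _ _ H). auto.
Qed.

Lemma ult_mem_congr f f' g g' : fn f -> fn f' -> fn g -> fn g' ->
  ult_eq d U f f' -> ult_eq d U g g' -> ult_mem d U f g -> ult_mem d U f' g'.
Proof.
  intros Hf Hf' Hg Hg' Ef Eg H. apply ult_eq_most in Ef, Eg; auto.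
  apply ult_mem_most in H; auto. apply ult_mem_most; auto.
  apply (most_mono _ _ (most_and _ _ H (most_and _ _ Ef Eg))).
  intros i _ (Hi & <- & <-). exact Hi.
Qed.

(** A set without minimal element yields a sequence that decreases modulo
    [U]; as [U] is closed under countable intersections, some coordinate of
    the sequence decreases throughout, against foundation. *)
Lemma ult_mem_wf W : (forall f, f ∈ W -> fn f) -> well_founded_on W (ult_mem d U).
Proof.
  intros HW s Hs [f0 Hf0]. apply NNPP. intros Hmin.
  destruct (choice_function s s (fun f g => ult_mem d U g f)) as (c & Hc & Hcf); [definable| |].
  { intros f Hf. apply NNPP. intros Hn. apply Hmin. exists f. split; [exact Hf|].
    intros g Hg Hgf. apply Hn. eauto. }
  destruct Hd as [(_ & w & Hw & Hwd) _].
  pose proof (proj1 (proj1 Hw)) as Hwo.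
  destruct (wf_recursion w (fun y x => y ∈ x)
    (fun n u => the (fun y => (exists m, is_succ n m /\ y = ap c (ap u m)) \/
      (~ (exists m, is_succ n m) /\ y = f0)))) as (t & Ht & E);
    [definable|definable|apply wf_mem|].
  assert (succ_inj : forall n m m', is_succ n m -> is_succ n m' -> m = m').
  { intros n m m' H H'.
    assert (m ∈ n) as H1 by (apply H; auto). assert (m' ∈ n) as H2 by (apply H'; auto).
    apply H' in H1. apply H in H2. destruct H1 as [H1|]; [|auto]. destruct H2 as [H2|]; [|auto].
    exfalso. destruct (zfc_foundation V HV (upair m m')) as (y & Hy & Hym).
    - exists m. apply in_upair. auto.
    - apply in_upair in Hy. destruct Hy as [->| ->].
      + apply (Hym m' H2), in_upair. auto.
      + apply (Hym m H1), in_upair. auto. }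
  assert (t_zero : forall n, n ∈ w -> ~ (exists m, is_succ n m) -> ap t n = f0).
  { intros n Hn Hz. rewrite E by exact Hn. apply the_eq; [auto|].
    intros z [(m & Hm & _)|[_ ->]]; [exfalso; eauto|reflexivity]. }
  assert (t_succ : forall n m, n ∈ w -> is_succ n m -> ap t n = ap c (ap t m)).
  { intros n m Hn Hm. rewrite E by exact Hn.
    assert (Hmn : m ∈ n) by (apply Hm; auto).
    assert (Hm' : m ∈ sep w (fun y => y ∈ n))
      by (apply in_sep; [definable|]; eauto using ordinal_trans).
    apply the_eq.
    - left. exists m. rewrite ap_lam; [auto|definable|exact Hm'].
    - intros z [(m' & Hm'' & ->)|[Hz _]]; [|exfalso; eauto].
      rewrite (succ_inj n m' m Hm'' Hm), ap_lam; [reflexivity|definable|exact Hm']. }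
  assert (t_in : forall n, n ∈ w -> ap t n ∈ s).
  { apply (wf_induction w (fun y x => y ∈ x) (fun n => ap t n ∈ s)); [definable|apply wf_mem|].
    intros n Hn IH. destruct (classic (exists m, is_succ n m)) as [[m Hm]|Hz].
    - rewrite (t_succ n m Hn Hm). apply (ap_in c s s); [exact Hc|].
      assert (m ∈ n) by (apply Hm; auto). apply IH; eauto using ordinal_trans.
    - rewrite t_zero; assumption. }
  assert (t_dec : forall m, m ∈ w -> most (fun i => ap (ap c (ap t m)) i ∈ ap (ap t m) i)).
  { intros m Hm. pose proof (t_in m Hm) as Htm. apply ult_mem_most.
    - apply HW, Hs, (ap_in c s s); assumption.
    - apply HW, Hs, Htm.
    - apply Hcf, Htm. }
  apply most_small_all in t_dec; [|definable|exact Hwd].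
  destruct (most_ex _ t_dec) as (i & Hi & Hdec).
  destruct (zfc_foundation V HV (img w (fun n => ap (ap t n) i))) as (y & Hy & Hym).
  - destruct (proj1 (proj2 (proj1 Hw))) as [n Hn]. exists (ap (ap t n) i).
    apply (in_img_intro w (fun n => ap (ap t n) i)); [definable|exact Hn].
  - apply in_img in Hy; [|definable]. destruct Hy as (m & Hm & ->).
    apply (Hym _ (Hdec m Hm)).
    destruct (limit_no_max w m (proj1 Hw) Hm) as (n & Hn & Hmn).
    set (k := cup m (sing m)).
    assert (Hk : is_succ k m) by (intros z; unfold k; rewrite in_cup, in_sing; tauto).
    assert (Hkw : k ∈ w).
    { apply (le_mem_trans k n w Hwo); [|exact Hn].
      pose proof (ordinal_mem w m Hwo Hm) as Hmo. pose proof (ordinal_mem w n Hwo Hn) as Hno.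
      apply transitive_subset_le; [exact Hno| |].
      - intros x Hx z Hz. apply Hk in Hx. apply Hk. left.
        destruct Hx as [Hx| ->]; [exact (ordinal_trans m z x Hmo Hz Hx)|exact Hz].
      - intros x Hx. apply Hk in Hx. destruct Hx as [Hx| ->]; [|exact Hmn].
        exact (ordinal_trans n x m Hno Hx Hmn). }
    apply in_img; [definable|]. exists k. split; [exact Hkw|].
    rewrite (t_succ k m Hkw Hk). reflexivity.
Qed.

(** ** The collapsing map *)

(** The collapsing map is a proper class, and therefore a relation glued from
    partial collapses. *)
Definition collapses f x : Prop := exists p, partial_collapse d U p /\ app p f x.

(** The domain consists of all functions from [d] to a transitive [T] that
    contains the values of [f]: a member of such a function modulo [U] takes
    values in [T] almost everywhere. *)
Lemma partial_collapse_exists f : fn f -> exists p, partial_collapse d U p /\ in_dom f p.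
Proof.
  intros Hf. destruct (transitive_closure (img d (ap f))) as (T & HT & HfT).
  set (W := funcs d T).
  assert (HW : forall g, g ∈ W -> fn g) by (intros g Hg; apply in_funcs in Hg; apply Hg).
  destruct (wf_recursion W (ult_mem d U)
    (fun g u => img (sep W (fun g' => ult_mem d U g' g)) (ap u))) as (p & Hp & E);
    [definable|definable|apply ult_mem_wf, HW|].
  assert (in_p : forall g y, g ∈ W ->
    y ∈ ap p g <-> exists g', g' ∈ W /\ ult_mem d U g' g /\ y = ap p g').
  { intros g y Hg. rewrite E by exact Hg. rewrite in_img by definable. split.
    - intros (g' & Hg' & ->). exists g'. rewrite ap_lam; [|definable|exact Hg'].
      apply in_sep in Hg'; [tauto|definable].
    - intros (g' & Hg' & Hgg' & ->). exists g'.
      assert (H : g' ∈ sep W (fun g' => ult_mem d U g' g)) by (apply in_sep; [definable|auto]).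
      rewrite ap_lam; [auto|definable|exact H]. }
  exists p. split; [split; [|split; [|split]]|].
  - apply Hp.
  - intros g Hg. apply (proj2 Hp) in Hg. apply HW, Hg.
  - intros g h Hg Hh Hhg. apply (proj2 Hp) in Hg. pose proof (HW g Hg) as Hgf.
    apply in_funcs in Hg. apply ult_mem_most in Hhg; [|exact Hh|exact Hgf].
    set (h' := lam d (fun i => ite (ap h i ∈ T) (ap h i) (ap g i))).
    exists h'. split.
    + apply (proj2 Hp), in_funcs, function_from_to_lam; [definable|].
      intros i Hi. destruct (classic (ap h i ∈ T)) as [H|H];
        [rewrite ite_true by exact H; exact H|rewrite ite_false by exact H].
      apply (ap_in g d T); assumption.
    + apply ult_eq_most; [exact Hh|apply fn_lam; definable|].
      apply (most_mono _ _ Hhg). intros i Hi H. unfold h'.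
      rewrite ap_lam; [|definable|exact Hi]. rewrite ite_true; [reflexivity|].
      apply (HT (ap g i)); [apply (ap_in g d T); assumption|exact H].
  - intros g x Hgx y. apply (app_iff p W) in Hgx; [|exact Hp]. destruct Hgx as [Hg ->].
    rewrite in_p by exact Hg. split.
    + intros (g' & Hg' & Hm & ->). exists g'. split; [exact Hm|]. apply (app_ap p W); assumption.
    + intros (g' & Hm & Hy). apply (app_iff p W) in Hy; [|exact Hp]. exists g'. tauto.
  - apply (proj2 Hp), in_funcs, function_from_to_iff. split; [exact Hf|].
    intros i Hi. apply HfT, in_img_intro; [definable|exact Hi].
Qed.

Lemma collapses_fn f x : collapses f x -> fn f.
Proof. intros (p & Hp & Hfx). apply (proj1 (proj2 Hp)). exists x. exact Hfx. Qed.

(** Two partial collapses may use different representatives.  By induction on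
    [x], equivalent members have equal values, so the values of [f] and [f']
    have the same elements. *)
Lemma collapses_unique f f' x x' :
  collapses f x -> collapses f' x' -> ult_eq d U f f' -> x = x'.
Proof.
  intros Hx. revert f f' x' Hx. pattern x. revert x.
  apply mem_induction; [unfold collapses; definable|].
  intros x IH f f' x' Hx Hx' Eff'.
  pose proof (collapses_fn _ _ Hx) as Hf. pose proof (collapses_fn _ _ Hx') as Hf'.
  destruct Hx as (p & Hp & Hfx). destruct Hx' as (p' & Hp' & Hfx').
  apply set_ext. intros y. split; intros Hy.
  - pose proof Hy as Hyx. apply (proj2 (proj2 (proj2 Hp)) f x Hfx) in Hy.
    destruct Hy as (g & Hgf & Hgy).
    assert (Hg : fn g) by (apply (proj1 (proj2 Hp)); exists y; exact Hgy).
    assert (Hgf' : ult_mem d U g f')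
      by (apply (ult_mem_congr g g f f'); auto using ult_eq_refl).
    destruct (proj1 (proj2 (proj2 Hp')) f' g) as (g' & [y' Hgy'] & Egg');
      [exists x'; exact Hfx'|exact Hg|exact Hgf'|].
    assert (Hg' : fn g') by (apply (proj1 (proj2 Hp')); exists y'; exact Hgy').
    rewrite (IH y Hyx g g' y'); [|exists p; auto|exists p'; auto|exact Egg'].
    apply (proj2 (proj2 (proj2 Hp')) f' x' Hfx'). exists g'. split; [|exact Hgy'].
    apply (ult_mem_congr g g' f' f'); auto using ult_eq_refl.
  - apply (proj2 (proj2 (proj2 Hp')) f' x' Hfx') in Hy. destruct Hy as (g' & Hgf' & Hgy').
    assert (Hg' : fn g') by (apply (proj1 (proj2 Hp')); exists y; exact Hgy').
    assert (Hgf : ult_mem d U g' f)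
      by (apply (ult_mem_congr g' g' f' f); auto using ult_eq_refl, ult_eq_sym).
    destruct (proj1 (proj2 (proj2 Hp)) f g') as (g & [y' Hgy] & Egg');
      [exists x; exact Hfx|exact Hg'|exact Hgf|].
    assert (Hg : fn g) by (apply (proj1 (proj2 Hp)); exists y'; exact Hgy).
    assert (Hyx : y' ∈ x).
    { apply (proj2 (proj2 (proj2 Hp)) f x Hfx). exists g. split; [|exact Hgy].
      apply (ult_mem_congr g' g f f); auto using ult_eq_refl. }
    rewrite <- (IH y' Hyx g g' y); [exact Hyx|exists p; auto|exists p'; auto|].
    apply ult_eq_sym; assumption.
Qed.

Definition pi f : V := the (collapses f).

Lemma dterm_pi t : dterm t -> dterm (fun e => pi (t e)).
Proof. apply (dterm_subst1 pi). unfold pi, collapses. definable. Qed.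

Ltac definable_named ::=
  lazymatch goal with
  | |- dterm (fun e => pi _) => apply dterm_pi
  | _ => definable_operation
  end.

Lemma collapses_pi f : fn f -> collapses f (pi f).
Proof.
  intros Hf. apply (the_spec (collapses f)).
  - destruct (partial_collapse_exists f Hf) as (p & Hp & x & Hx). exists x, p. auto.
  - intros x y Hx Hy. apply (collapses_unique f f); auto using ult_eq_refl.
Qed.

Lemma collapses_eq f x : collapses f x -> x = pi f.
Proof.
  intros H. pose proof (collapses_fn f x H) as Hf.
  apply (collapses_unique f f); auto using ult_eq_refl, collapses_pi.
Qed.

Lemma pi_congr f g : fn f -> fn g -> ult_eq d U f g -> pi f = pi g.
Proof. intros Hf Hg. apply (collapses_unique f g); apply collapses_pi; assumption. Qed.

Lemma in_pi f y : fn f -> y ∈ pi f <-> exists g, fn g /\ ult_mem d U g f /\ y = pi g.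
Proof.
  intros Hf. pose proof (collapses_pi f Hf) as (p & Hp & Hfp). split.
  - intros Hy. apply (proj2 (proj2 (proj2 Hp)) f (pi f) Hfp) in Hy.
    destruct Hy as (g & Hgf & Hgy). exists g.
    assert (Hg : collapses g y) by (exists p; auto).
    eauto using collapses_fn, collapses_eq.
  - intros (g & Hg & Hgf & ->).
    destruct (proj1 (proj2 (proj2 Hp)) f g) as (g' & [y Hy] & E);
      [exists (pi f); exact Hfp|exact Hg|exact Hgf|].
    assert (Hg' : collapses g' y) by (exists p; auto).
    pose proof (collapses_fn _ _ Hg') as Hg'f.
    apply (proj2 (proj2 (proj2 Hp)) f (pi f) Hfp). exists g'. split.
    + apply (ult_mem_congr g g' f f); auto using ult_eq_refl.
    + rewrite (pi_congr g g'); auto. rewrite <- (collapses_eq g' y Hg'). exact Hy.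
Qed.

Lemma Ult_pi x : Ult d U x <-> exists f, fn f /\ x = pi f.
Proof.
  split.
  - intros (p & f & Hp & Hfx). assert (H : collapses f x) by (exists p; auto).
    exists f. eauto using collapses_fn, collapses_eq.
  - intros (f & Hf & ->). destruct (collapses_pi f Hf) as (p & Hp & H). exists p, f. auto.
Qed.

Lemma most_choice b (Q : V -> V -> Prop) : dfn2 Q ->
  most (fun i => exists y, y ∈ b /\ Q i y) -> exists h, fn h /\ most (fun i => Q i (ap h i)).
Proof.
  intros HQ H. destruct (most_ex _ H) as (i0 & _ & y0 & Hy0 & _).
  destruct (choice_function d b (fun i y => (exists z, z ∈ b /\ Q i z) -> Q i y))
    as (h & Hh & HhQ); [definable| |].
  - intros i Hi. destruct (classic (exists z, z ∈ b /\ Q i z)) as [(z & Hz)|Hn].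
    + exists z. tauto.
    + exists y0. tauto.
  - exists h. split; [apply Hh|]. apply (most_mono _ _ H). intros i Hi. apply HhQ, Hi.
Qed.

(** Witnesses for an element of [f(i)] form an element of the ultrapower. *)
Lemma most_pick f (Q : V -> V -> Prop) : fn f -> dfn2 Q ->
  most (fun i => exists y, y ∈ ap f i /\ Q i y) ->
  exists h, fn h /\ ult_mem d U h f /\ most (fun i => Q i (ap h i)).
Proof.
  intros Hf HQ H.
  destruct (most_choice (bigcup (img d (ap f))) (fun i y => y ∈ ap f i /\ Q i y))
    as (h & Hh & HhQ); [definable| |].
  - apply (most_mono _ _ H). intros i Hi (y & Hy & Hyi). exists y. split; [|auto].
    apply in_bigcup. exists (ap f i). split; [|exact Hy]. apply in_img_intro; [definable|exact Hi].
  - exists h. split; [exact Hh|]. split.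
    + apply ult_mem_most; [exact Hh|exact Hf|]. apply (most_mono _ _ HhQ). tauto.
    + apply (most_mono _ _ HhQ). tauto.
Qed.

(** Only injectivity below [f] enters, so that this can serve in the inductive
    proof of injectivity. *)
Lemma pi_subset_of_injective f g : fn f -> fn g ->
  (forall h h', fn h -> fn h' -> pi h ∈ pi f -> pi h = pi h' -> ult_eq d U h h') ->
  subset (pi f) (pi g) -> most (fun i => subset (ap f i) (ap g i)).
Proof.
  intros Hf Hg Hinj Hfg. apply NNPP. intros Hn. apply most_not in Hn; [|definable].
  destruct (most_pick f (fun i y => y ∉ ap g i)) as (h & Hh & Hhf & Hhg);
    [exact Hf|definable| |].
  - apply (most_mono _ _ Hn). intros i _ Hi. exact (not_subset_ex _ _ Hi).
  - assert (Hpi : pi h ∈ pi f) by (apply in_pi; eauto).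
    pose proof (Hfg _ Hpi) as Hpi'. apply in_pi in Hpi'; [|exact Hg].
    destruct Hpi' as (h' & Hh' & Hhg' & E).
    apply (not_most_both (fun i => ap h i ∈ ap g i)); [|exact Hhg].
    apply ult_mem_most; [exact Hh|exact Hg|].
    apply (ult_mem_congr h' h g g); auto using ult_eq_refl, ult_eq_sym.
Qed.

Lemma pi_injective f g : fn f -> fn g -> pi f = pi g -> ult_eq d U f g.
Proof.
  enough (H : forall x f g, fn f -> fn g -> x = pi f -> x = pi g -> ult_eq d U f g) by eauto.
  clear f g.
  apply (mem_induction (fun x => forall f g, fn f -> fn g -> x = pi f -> x = pi g ->
    ult_eq d U f g)); [definable|].
  intros x IH f g Hf Hg Ef Eg. apply ult_eq_most; [exact Hf|exact Hg|].
  assert (H : most (fun i => subset (ap f i) (ap g i))).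
  { apply pi_subset_of_injective; [exact Hf|exact Hg| |].
    - intros h h' Hh Hh' Hin E. rewrite <- Ef in Hin. apply (IH (pi h)); auto.
    - rewrite <- Ef, <- Eg. intros y Hy. exact Hy. }
  assert (H' : most (fun i => subset (ap g i) (ap f i))).
  { apply pi_subset_of_injective; [exact Hg|exact Hf| |].
    - intros h h' Hh Hh' Hin E. rewrite <- Eg in Hin. apply (IH (pi h)); auto.
    - rewrite <- Ef, <- Eg. intros y Hy. exact Hy. }
  apply (most_mono _ _ (most_and _ _ H H')). intros i _ [Hi Hi'].
  apply set_ext. intros y. split; [apply Hi|apply Hi'].
Qed.

Lemma pi_subset f g : fn f -> fn g -> subset (pi f) (pi g) ->
  most (fun i => subset (ap f i) (ap g i)).
Proof. intros Hf Hg. apply pi_subset_of_injective; auto using pi_injective. Qed.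

(** The ultrapower embedding moves no ordinal downwards; in terms of
    representatives, a function that represents an ordinal [b] takes values
    at most [b] almost everywhere.  By induction its values are subsets of [b],
    and they are transitive because [b] is. *)
Lemma pi_ordinal_le f b : ordinal b -> fn f -> pi f = b -> most (fun i => le (ap f i) b).
Proof.
  revert f. pattern b. revert b. apply mem_induction; [definable|].
  intros b IH f Hb Hf E.
  assert (IH' : forall h, fn h -> ult_mem d U h f -> most (fun i => ap h i ∈ b)).
  { intros h Hh Hhf.
    assert (Hhb : pi h ∈ b) by (rewrite <- E; apply in_pi; eauto).
    apply (most_mono _ _ (IH (pi h) Hhb h (ordinal_mem b _ Hb Hhb) Hh eq_refl)).
    intros i _ Hi. exact (le_mem_trans _ _ b Hb Hi Hhb). }
  assert (Hsub : most (fun i => subset (ap f i) b)).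
  { apply NNPP. intros Hn. apply most_not in Hn; [|definable].
    destruct (most_pick f (fun i y => y ∉ b)) as (h & Hh & Hhf & Hhb); [exact Hf|definable| |].
    - apply (most_mono _ _ Hn). intros i _ Hi. exact (not_subset_ex _ _ Hi).
    - exact (not_most_both _ (IH' h Hh Hhf) Hhb). }
  assert (Htr : most (fun i => transitive (ap f i))).
  { apply NNPP. intros Hn. apply most_not in Hn; [|definable].
    destruct (most_pick f (fun i y => ~ subset y (ap f i))) as (h & Hh & Hhf & Hhn);
      [exact Hf|definable| |].
    { apply (most_mono _ _ Hn). intros i _ Hi. apply NNPP. intros Hi'. apply Hi.
      intros y Hy. apply NNPP. intros Hy'. eauto. }
    apply (not_most_both (fun i => subset (ap h i) (ap f i))); [|exact Hhn].
    apply pi_subset; [exact Hh|exact Hf|]. rewrite E.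
    apply (proj1 Hb). rewrite <- E. apply in_pi; eauto. }
  apply (most_mono _ _ (most_and _ _ Hsub Htr)). intros i _ [H1 H2].
  apply transitive_subset_le; assumption.
Qed.

(** This bounds the representatives of all subsets of [l] by a set, from which
    the axiom of choice can then select. *)
Lemma pi_subset_ordinal f l : ordinal l -> fn f -> subset (pi f) l ->
  exists f', function_from_to f' d (power l) /\ pi f' = pi f.
Proof.
  intros Hl Hf Hfl.
  assert (H : most (fun i => subset (ap f i) l)).
  { apply NNPP. intros Hn. apply most_not in Hn; [|definable].
    destruct (most_pick f (fun i y => y ∉ l)) as (h & Hh & Hhf & Hhl); [exact Hf|definable| |].
    { apply (most_mono _ _ Hn). intros i _ Hi. exact (not_subset_ex _ _ Hi). }
    apply (not_most_both (fun i => ap h i ∈ l)); [|exact Hhl].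
    assert (Hhl' : pi h ∈ l) by (apply Hfl, in_pi; eauto).
    apply (most_mono _ _ (pi_ordinal_le h (pi h) (ordinal_mem l _ Hl Hhl') Hh eq_refl)).
    intros i _ Hi. exact (le_mem_trans _ _ l Hl Hi Hhl'). }
  exists (lam d (fun i => sep (ap f i) (fun y => y ∈ l))). split.
  - apply function_from_to_lam; [definable|]. intros i Hi. apply in_power.
    intros y Hy. apply in_sep in Hy; [tauto|definable].
  - apply pi_congr; [apply fn_lam; definable|exact Hf|].
    apply ult_eq_most; [apply fn_lam; definable|exact Hf|].
    apply (most_mono _ _ H). intros i Hi Hil. rewrite ap_lam; [|definable|exact Hi].
    apply set_ext. intros y. rewrite in_sep by definable. split; [tauto|auto].
Qed.

Notation val f ξ i := (ap (ap f ξ) i).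

(** Replacement alone does not select from the proper class of representatives
    of each [B(ξ)]; restricting to values in [power l] makes it a set. *)
Lemma representatives k l (B : V -> V) : ordinal l -> dterm1 B ->
  (forall ξ, ξ ∈ k -> subset (B ξ) l /\ Ult d U (B ξ)) ->
  exists f, forall ξ, ξ ∈ k -> fn (ap f ξ) /\ pi (ap f ξ) = B ξ.
Proof.
  intros Hl HB H.
  destruct (choice_function k (funcs d (power l)) (fun ξ g => pi g = B ξ)) as (f & Hf & HfB);
    [definable| |].
  - intros ξ Hξ. destruct (H ξ Hξ) as [Hsub HU']. apply Ult_pi in HU'.
    destruct HU' as (g & Hg & E). rewrite E in Hsub.
    destruct (pi_subset_ordinal g l Hl Hg Hsub) as (g' & Hg' & E').
    exists g'. split; [apply in_funcs, Hg'|congruence].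
  - exists f. intros ξ Hξ. split; [|auto].
    apply (ap_in f k _ ξ Hf) in Hξ. apply in_funcs in Hξ. apply Hξ.
Qed.

(** * Unions that belong to the ultrapower *)

(** The hypotheses say that, modulo [U], the members of [F] are exactly the
    members of the [f(ξ)], so that [F] represents the union. *)
Lemma union_in_Ult k f F A : (forall ξ, ξ ∈ k -> fn (ap f ξ)) -> fn F ->
  (forall ξ, ξ ∈ k -> most (fun i => subset (val f ξ i) (ap F i))) ->
  (forall h, fn h -> ult_mem d U h F -> exists ξ, ξ ∈ k /\ ult_mem d U h (ap f ξ)) ->
  (forall y, y ∈ A <-> exists ξ, ξ ∈ k /\ y ∈ pi (ap f ξ)) ->
  Ult d U A.
Proof.
  intros Hf HF Hsub Hsup HA. apply Ult_pi. exists F. split; [exact HF|].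
  apply set_ext. intros y. rewrite HA, in_pi by exact HF. split.
  - intros (ξ & Hξ & Hy). apply in_pi in Hy; [|auto]. destruct Hy as (h & Hh & Hhf & ->).
    exists h. split; [exact Hh|]. split; [|reflexivity].
    apply ult_mem_most in Hhf; [|exact Hh|auto]. apply ult_mem_most; [exact Hh|exact HF|].
    apply (most_mono _ _ (most_and _ _ Hhf (Hsub ξ Hξ))). intros i _ [Hi Hs]. exact (Hs _ Hi).
  - intros (h & Hh & HhF & ->). destruct (Hsup h Hh HhF) as (ξ & Hξ & Hhf).
    exists ξ. split; [exact Hξ|]. apply in_pi; eauto.
Qed.

(** For sequences of length at most [d], the union up to the coordinate [i]
    works: by normality, a member of [F] is a member of some fixed [f(ξ)]. *)
Lemma short_union_in_Ult k f A : ordinal k -> le k d ->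
  (forall ξ, ξ ∈ k -> fn (ap f ξ)) ->
  (forall y, y ∈ A <-> exists ξ, ξ ∈ k /\ y ∈ pi (ap f ξ)) ->
  Ult d U A.
Proof.
  intros Hk Hkd Hf HA. pose proof measurable_ordinal as Hdo.
  set (F := lam d (fun i => bigcup (img (sep k (fun ξ => ξ ∈ i)) (fun ξ => val f ξ i)))).
  assert (HF : fn F) by (apply fn_lam; definable).
  assert (in_F : forall i y, i ∈ d ->
    y ∈ ap F i <-> exists ξ, ξ ∈ k /\ ξ ∈ i /\ y ∈ val f ξ i).
  { intros i y Hi. unfold F. rewrite ap_lam; [|definable|exact Hi]. rewrite in_bigcup. split.
    - intros (z & Hz & Hy). apply in_img in Hz; [|definable]. destruct Hz as (ξ & Hξ & ->).
      apply in_sep in Hξ; [|definable]. exists ξ. tauto.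
    - intros (ξ & Hξ & Hξi & Hy). exists (val f ξ i). split; [|exact Hy].
      apply (in_img_intro _ (fun ξ => val f ξ i)); [definable|]. apply in_sep; [definable|auto]. }
  apply (union_in_Ult k f F); [exact Hf|exact HF| | |exact HA].
  - intros ξ Hξ.
    assert (Hξd : ξ ∈ d) by (apply (le_subset k d); assumption).
    apply (most_mono _ _ (most_above ξ Hξd)). intros i Hi Hξi y Hy. apply in_F; eauto.
  - intros h Hh HhF. apply NNPP. intros Hn. apply ult_mem_most in HhF; [|exact Hh|exact HF].
    assert (H : forall ξ, ξ ∈ d -> most (fun i => ~ (ξ ∈ k /\ ap h i ∈ val f ξ i))).
    { intros ξ _. destruct (classic (ξ ∈ k)) as [Hξ|Hξ].
      - apply most_not; [definable|]. intros H. apply Hn. exists ξ. split; [exact Hξ|].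
        apply ult_mem_most; [exact Hh|auto|]. apply (most_mono _ _ H). tauto.
      - apply most_all. tauto. }
    apply most_diagonal in H; [|definable].
    destruct (most_ex _ (most_and _ _ HhF H)) as (i & Hi & HiF & Hi').
    apply in_F in HiF; [|exact Hi]. destruct HiF as (ξ & Hξ & Hξi & Hy).
    apply (Hi' ξ Hξi). auto.
Qed.

(** [F(i)] collects the [f(ξ)(i)] that [D] considers to be contained in most
    later [f(ζ)(i)].  Both required properties of [F] come from common elements
    of [d] many sets in [D]. *)
Lemma long_union_in_Ult k D f A : ordinal k ->
  jointly_unbounded d k D ->
  decides d k D (fun ξ i ζ => subset (val f ξ i) (val f ζ i)) ->
  (forall ξ, ξ ∈ k -> fn (ap f ξ)) ->
  (forall ξ ζ, ζ ∈ k -> le ξ ζ -> subset (pi (ap f ξ)) (pi (ap f ζ))) ->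
  (forall y, y ∈ A <-> exists ξ, ξ ∈ k /\ y ∈ pi (ap f ξ)) ->
  Ult d U A.
Proof.
  intros Hk HD Hdec Hf Hmono HA.
  set (Z := fun ξ i => sep k (fun ζ => subset (val f ξ i) (val f ζ i))).
  assert (HZ : dterm2 Z) by (unfold Z; definable).
  assert (in_Z : forall ξ i ζ, ζ ∈ Z ξ i <-> ζ ∈ k /\ subset (val f ξ i) (val f ζ i))
    by (intros ξ i ζ; unfold Z; rewrite in_sep by definable; tauto).
  set (F := lam d (fun i => bigcup (img (sep k (fun ξ => Z ξ i ∈ D)) (fun ξ => val f ξ i)))).
  assert (HF : fn F) by (apply fn_lam; definable).
  assert (in_F : forall i y, i ∈ d ->
    y ∈ ap F i <-> exists ξ, ξ ∈ k /\ Z ξ i ∈ D /\ y ∈ val f ξ i).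
  { intros i y Hi. unfold F. rewrite ap_lam; [|definable|exact Hi]. rewrite in_bigcup. split.
    - intros (z & Hz & Hy). apply in_img in Hz; [|definable]. destruct Hz as (ξ & Hξ & ->).
      apply in_sep in Hξ; [|definable]. exists ξ. tauto.
    - intros (ξ & Hξ & Hξi & Hy). exists (val f ξ i). split; [|exact Hy].
      apply (in_img_intro _ (fun ξ => val f ξ i)); [definable|]. apply in_sep; [definable|auto]. }
  apply (union_in_Ult k f F); [exact Hf|exact HF| | |exact HA].
  - intros ξ Hξ.
    set (Y := lam d (fun i => ite (Z ξ i ∈ D) (Z ξ i)
      (sep k (fun ζ => ~ subset (val f ξ i) (val f ζ i))))).
    destruct (HD Y) with (ξ := ξ) as (ζ & Hζ & Hξζ & HζY); [|exact Hξ|].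
    + apply function_from_to_lam; [definable|]. intros i Hi.
      destruct (classic (Z ξ i ∈ D)) as [H|H].
      * rewrite ite_true; assumption.
      * rewrite ite_false by assumption. destruct (Hdec ξ i Hξ Hi) as [H'|H']; [contradiction|].
        exact H'.
    + assert (Hsub := pi_subset _ _ (Hf ξ Hξ) (Hf ζ Hζ) (Hmono ξ ζ Hζ Hξζ)).
      apply (most_mono _ _ Hsub). intros i Hi Hs y Hy. apply in_F; [exact Hi|].
      exists ξ. split; [exact Hξ|]. split; [|exact Hy]. apply NNPP. intros HZD.
      specialize (HζY i Hi). unfold Y in HζY.
      rewrite ap_lam in HζY; [|definable|exact Hi].
      rewrite ite_false in HζY by exact HZD. apply in_sep in HζY; [tauto|definable].
  - intros h Hh HhF. apply ult_mem_most in HhF; [|exact Hh|exact HF].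
    destruct (most_ex _ HhF) as (i0 & Hi0 & Hhi0). apply in_F in Hhi0; [|exact Hi0].
    destruct Hhi0 as (ξ0 & Hξ0 & HD0 & _).
    destruct (choice_function d D (fun i y => ap h i ∈ ap F i ->
      exists ξ, ξ ∈ k /\ y = Z ξ i /\ ap h i ∈ val f ξ i)) as (Y & HY & HYZ); [definable| |].
    { intros i Hi. destruct (classic (ap h i ∈ ap F i)) as [H|H].
      - pose proof H as H'. apply in_F in H'; [|exact Hi]. destruct H' as (ξ & Hξ & Hξi & Hy).
        exists (Z ξ i). split; [exact Hξi|]. eauto.
      - exists (Z ξ0 i0). tauto. }
    destruct (HD Y HY ξ0 Hξ0) as (ζ & Hζ & _ & HζY). exists ζ. split; [exact Hζ|].
    apply ult_mem_most; [exact Hh|auto|]. apply (most_mono _ _ HhF). intros i Hi Hhi.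
    destruct (HYZ i Hi Hhi) as (ξ & Hξ & E & Hy). specialize (HζY i Hi). rewrite E in HζY.
    apply in_Z in HζY. apply HζY, Hy.
Qed.


(** * Fresh sets *)

Lemma fresh_initial_segments l A : limit_ordinal l -> unbounded_in A l -> fresh (Ult d U) A ->
  ~ Ult d U A /\ forall a b, a ∈ l -> (forall z, z ∈ b <-> z ∈ A /\ z ∈ a) -> Ult d U b.
Proof.
  intros Hl [HA Hunb] (_ & HnA & m & (Hm & Hbd & _) & Hseg). split; [exact HnA|].
  intros a b Ha Hb. pose proof (proj1 Hl) as Hlo.
  assert (Ham : a ∈ m).
  { destruct (limit_no_max l a Hl Ha) as (x & Hx & Hax).
    destruct (Hunb x Hx) as (y & Hy & Hxy).
    apply (le_subset y m Hm (Hbd y Hy)), (le_subset x y); [|exact Hxy|exact Hax].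
    exact (ordinal_mem l y Hlo (HA y Hy)). }
  destruct (Hseg a Ham) as (b' & Hb' & HU').
  replace b with b'; [exact HU'|]. apply set_ext. intros z. rewrite Hb, Hb'. tauto.
Qed.

(** Reduces the refutation of freshness to showing that the union of an
    increasing sequence of sets in the ultrapower is in the ultrapower. *)
Lemma fresh_representatives k l A : limit_ordinal l -> is_cof k l ->
  unbounded_in A l -> fresh (Ult d U) A -> ~ Ult d U A /\ exists f,
    (forall ξ, ξ ∈ k -> fn (ap f ξ)) /\
    (forall ξ ζ, ζ ∈ k -> le ξ ζ -> subset (pi (ap f ξ)) (pi (ap f ζ))) /\
    (forall y, y ∈ A <-> exists ξ, ξ ∈ k /\ y ∈ pi (ap f ξ)).
Proof.
  intros Hl Hk HA Hfr. destruct (fresh_initial_segments l A Hl HA Hfr) as [HnA Hseg].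
  split; [exact HnA|]. pose proof (proj1 Hl) as Hlo. pose proof (proj1 Hk) as Hko.
  destruct (cofinal_initial_segments k l A Hl Hk (proj1 HA)) as (B & HB & HBseg & HBmono & HBA).
  destruct (representatives k l B Hlo HB) as (f & Hf).
  { intros ξ Hξ. destruct (HBseg ξ Hξ) as (α & Hα & HBα). split; [|exact (Hseg α _ Hα HBα)].
    intros z Hz. apply HBα in Hz. apply HA. tauto. }
  exists f. split; [|split].
  - intros ξ Hξ. apply Hf, Hξ.
  - intros ξ ζ Hζ Hle. rewrite (proj2 (Hf ζ Hζ)), (proj2 (Hf ξ (le_mem_trans ξ ζ k Hko Hle Hζ))).
    apply HBmono; assumption.
  - intros y. rewrite HBA. split; intros (ξ & Hξ & Hy); exists ξ; (split; [exact Hξ|]).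
    + rewrite (proj2 (Hf ξ Hξ)). exact Hy.
    + rewrite (proj2 (Hf ξ Hξ)) in Hy. exact Hy.
Qed.

Lemma no_fresh_short_cofinality k l : limit_ordinal l -> is_cof k l -> le k d ->
  no_fresh_unbounded_subset (Ult d U) l.
Proof.
  intros Hl Hk Hkd (A & HA & Hfr).
  destruct (fresh_representatives k l A Hl Hk HA Hfr) as (HnA & f & Hf & _ & HfA).
  apply HnA, (short_union_in_Ult k f A); auto. apply Hk.
Qed.

Lemma no_fresh_deciding_family k l : limit_ordinal l -> is_cof k l ->
  (forall b : V -> V -> V -> Prop, dfn3 b -> exists D, jointly_unbounded d k D /\ decides d k D b) ->
  no_fresh_unbounded_subset (Ult d U) l.
Proof.
  intros Hl Hk HD (A & HA & Hfr).
  destruct (fresh_representatives k l A Hl Hk HA Hfr) as (HnA & f & Hf & Hmono & HfA).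
  destruct (HD (fun ξ i ζ => subset (val f ξ i) (val f ζ i))) as (D & HDu & HDd); [definable|].
  apply HnA, (long_union_in_Ult k D f A); auto. apply Hk.
Qed.

Lemma no_fresh_complete_ultrafilter k l n D : limit_ordinal l -> is_cof k l ->
  ordinal n -> d ∈ n -> ultrafilter k D -> closed_below n k D ->
  (forall x, cobounded_in x k -> x ∈ D) -> no_fresh_unbounded_subset (Ult d U) l.
Proof.
  intros Hl Hk Hn Hdn HD Hcl Hcob. apply (no_fresh_deciding_family k l Hl Hk).
  intros b Hb. exists D. split.
  - apply (complete_ultrafilter_jointly_unbounded d k n); assumption.
  - apply ultrafilter_decides; assumption.
Qed.

End Ultrapower.

Theorem proposition1p2 (V : Type) (M : Membership V) (HV : ZFC V)
    (delta U lam : V)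
    (Hdelta : measurable delta)
    (HU : normal_ultrafilter delta U)
    (Hlam : limit_ordinal lam) :
  (forall cf : V, is_cof cf lam ->
     (exists delta_plus, is_card_succ delta_plus delta /\ cf ∈ delta_plus)
       \/ weakly_compact cf ->
     no_fresh_unbounded_subset (Ult delta U) lam)
  /\
  (forall cf c : V, is_cof cf lam -> is_two_pow c delta -> c ∈ cf ->
     (exists c_plus F : V, is_card_succ c_plus c /\
        ultrafilter cf F /\ closed_below c_plus cf F /\
        forall x, cobounded_in x cf -> x ∈ F) ->
     no_fresh_unbounded_subset (Ult delta U) lam)
  /\
  ((exists kappa cf : V, strongly_compact kappa /\ is_cof cf lam /\
      delta ∈ kappa /\ le kappa cf) ->
   no_fresh_unbounded_subset (Ult delta U) lam).
Proof.
  pose proof (measurable_ordinal delta Hdelta) as Hdo.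
  split; [|split].
  - intros k Hk Hcase. pose proof (proj1 Hk) as Hko.
    pose proof (cofinality_regular k lam Hlam Hk) as Hr.
    destruct (classic (delta ∈ k)) as [Hdk|Hdk].
    + destruct Hcase as [(s & (_ & _ & Hs) & Hks)|Hwc].
      * exfalso. pose proof (regular_is_cardinal k Hko Hr) as Hkc.
        exact (le_not_mem s k Hko (Hs k Hkc Hdk) Hks).
      * apply (no_fresh_deciding_family delta U Hdelta HU k lam Hlam Hk).
        intros b Hb. apply weakly_compact_decides; assumption.
    + apply (no_fresh_short_cofinality delta U Hdelta HU k lam Hlam Hk).
      apply not_mem_le; assumption.
  - intros k c Hk Hc _ (n & D & (Hn & Hcn & _) & HD & Hcl & Hcob).
    apply (no_fresh_complete_ultrafilter delta U Hdelta HU k lam n D); auto.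
    + apply Hn.
    + apply (ordinal_trans n delta c); [apply Hn|apply mem_two_pow; assumption|exact Hcn].
  - intros (q & k & Hq & Hk & Hdq & Hqk). pose proof (proj1 Hk) as Hko.
    destruct (cobounded_filter_extends q k) as (D & HD & Hcl & Hcob); auto.
    + exact (cofinality_regular k lam Hlam Hk).
    + exists delta. apply (le_subset q k); assumption.
    + apply (no_fresh_complete_ultrafilter delta U Hdelta HU k lam q D); auto.
      apply Hq.
Qed.
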